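(* Let $M^{2n+1}(\varphi,\xi,\eta,g)$ be a Kenmotsu manifold of dimension $2n+1$ with $n>1$. Suppose that $g$ represents an $\eta$-Ricci soliton with potential vector field $V$, i.e. there are real constants $\lambda,\mu$ such that $$\tfrac12\,\mathcal{L}_V g+\mathrm{Ric}+\lambda\,g+\mu\,\eta\otimes\eta=0 ,$$ and that $V$ is an infinitesimal contact transformation, i.e. $\mathcal{L}_V\eta=\rho\,\eta$ for some smooth function $\rho:M\to\mathbb{R}$. Then $V$ is strict (i.e. $\rho=0$) and $(M,g)$ is an Einstein manifold with constant scalar curvature $r=-2n(2n+1)$.
   Context: An almost contact structure on a smooth manifold $M^{2n+1}$ of dimension $2n+1$ is a triple $(\varphi,\xi,\eta)$, where $\varphi$ is a $(1,1)$-tensor, $\xi$ a vector field (the Reeb vector field) and $\eta$ a $1$-form with $\varphi^2=-I+\eta\otimes\xi$ and $\eta(\xi)=1$. A Riemannian metric $g$ is compatible if $g(\varphi X,\varphi Y)=g(X,Y)-\eta(X)\eta(Y)$ for all vector fields $X,Y$; then $M(\varphi,\xi,\eta,g)$ is an almost contact metric manifold. It is a Kenmotsu manifold if $(\nabla_X\varphi)Y=g(\varphi X,Y)\,\xi-\eta(Y)\,\varphi X$ for all vector fields $X,Y$, where $\nabla$ is the Levi-Civita connection of $g$. Here $\mathcal{L}_V$ is the Lie derivative along $V$, $\mathrm{Ric}$ the Ricci tensor, $r$ the scalar curvature of $g$, and $(\eta\otimes\eta)(X,Y)=\eta(X)\eta(Y)$. Einstein means that $\mathrm{Ric}$ is a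 constant multiple of $g$. *)

(* Defs.v *)
From HB Require Import structures.
From mathcomp Require Import all_boot all_order all_algebra.
From mathcomp Require Import all_classical all_reals all_analysis.
Set Implicit Arguments.
Unset Strict Implicit.
Unset Printing Implicit Defensive.
Import Order.TTheory GRing.Theory Num.Theory.
Import numFieldNormedType.Exports.
Local Open Scope classical_set_scope.
Local Open Scope ring_scope.

(* C^k and C^infinity functions on an open set U of R^m: all partial
   derivatives up to order k (resp. of every order) exist and are continuous. *)
Fixpoint Ck_on (R : realType) (m k : nat) (U : set 'rV[R]_m)
    (f : 'rV[R]_m -> R) : Prop :=
  (forall x, U x -> {for x, continuous f}) /\
  (if k is k'.+1 then
     forall i : 'I_m, (forall x, U x -> derivable f x (delta_mx 0 i)) /\
                      Ck_on k' U (fun x => 'D_(delta_mx 0 i) f x)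
   else True).

Definition smooth_on (R : realType) (m : nat) (U : set 'rV[R]_m)
    (f : 'rV[R]_m -> R) : Prop := forall k, Ck_on k U f.

Definition smooth_mx_on (R : realType) (m a b : nat) (U : set 'rV[R]_m)
    (F : 'rV[R]_m -> 'M[R]_(a, b)) : Prop :=
  forall i j, smooth_on U (fun x => F x i j).

(* The values of chart_map outside chart_dom, and those of chart_inv outside
   the image of chart_dom, are irrelevant. *)
Record chart (R : realType) (m : nat) (M : topologicalType) := Chart {
  chart_dom : set M;
  chart_map : M -> 'rV[R]_m;
  chart_inv : 'rV[R]_m -> M;
  chart_dom_open : open chart_dom;
  chart_img_open : open (chart_map @` chart_dom);
  chart_mapK : forall p, chart_dom p -> chart_inv (chart_map p) = p;
  chart_map_continuous :
    forall p, chart_dom p -> {for p, continuous chart_map};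
  chart_inv_continuous :
    forall x, (chart_map @` chart_dom) x -> {for x, continuous chart_inv}
}.

Definition chart_img (R : realType) (m : nat) (M : topologicalType)
  (c : chart R m M) : set 'rV[R]_m := chart_map c @` chart_dom c.

Definition transition (R : realType) (m : nat) (M : topologicalType)
  (c d : chart R m M) : 'rV[R]_m -> 'rV[R]_m :=
  fun x => chart_map d (chart_inv c x).

Definition overlap (R : realType) (m : nat) (M : topologicalType)
  (c d : chart R m M) : set 'rV[R]_m :=
  [set x | chart_img c x /\ chart_dom d (chart_inv c x)].

(* The atlas is not required to be maximal: any atlas determines the smooth
   structure and the notions below only need one. *)
Record smooth_manifold (R : realType) (m : nat) := SmoothManifold {
  pt :> topologicalType;
  pt_hausdorff : hausdorff_space pt;
  pt_second_countable : @second_countable pt;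
  atlas_index : Type;
  atlas : atlas_index -> chart R m pt;
  atlas_cover : forall p : pt, exists c, chart_dom (atlas c) p;
  atlas_smooth : forall c d,
    smooth_mx_on (overlap (atlas c) (atlas d)) (transition (atlas c) (atlas d))
}.

Definition img (R : realType) (m : nat) (M : smooth_manifold R m)
  (c : atlas_index M) : set 'rV[R]_m := chart_img (atlas c).

Definition ovl (R : realType) (m : nat) (M : smooth_manifold R m)
  (c d : atlas_index M) : set 'rV[R]_m := overlap (atlas c) (atlas d).

Definition trans (R : realType) (m : nat) (M : smooth_manifold R m)
  (c d : atlas_index M) : 'rV[R]_m -> 'rV[R]_m :=
  transition (atlas c) (atlas d).

Definition smooth_function (R : realType) (m : nat) (M : smooth_manifold R m)
    (f : M -> R) : Prop :=
  forall c : atlas_index M,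
    smooth_on (img c) (fun x => f (chart_inv (atlas c) x)).

(* Pointwise algebra in a chart. Tangent vectors are row vectors, covectors are
   column vectors; a (1,1)-tensor P acts by v |-> v *m P. *)
Definition pairing (R : realType) (m : nat) (a : 'cV[R]_m) (v : 'rV[R]_m) : R :=
  (v *m a) 0 0.

Definition bilin (R : realType) (m : nat) (B : 'M[R]_m) (u v : 'rV[R]_m) : R :=
  (u *m B *m v^T) 0 0.

(* A tensor field is a family of smooth component functions, one for each chart
   of the atlas, related by the tensorial transformation law; 'D_v (trans c d) x
   is the image of v under the differential at x of the change of coordinates. *)
Record vector_field (R : realType) (m : nat) (M : smooth_manifold R m) :=
  VectorField {
    vf_comp :> atlas_index M -> 'rV[R]_m -> 'rV[R]_m;
    vf_smooth : forall c, smooth_mx_on (img c) (vf_comp c);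
    vf_trans : forall c d x, ovl c d x ->
      vf_comp d (trans c d x) = 'D_(vf_comp c x) (trans c d) x
  }.

Record one_form (R : realType) (m : nat) (M : smooth_manifold R m) :=
  OneForm {
    of_comp :> atlas_index M -> 'rV[R]_m -> 'cV[R]_m;
    of_smooth : forall c, smooth_mx_on (img c) (of_comp c);
    of_trans : forall c d x, ovl c d x -> forall v : 'rV[R]_m,
      pairing (of_comp c x) v =
      pairing (of_comp d (trans c d x)) ('D_v (trans c d) x)
  }.

Record tensor11 (R : realType) (m : nat) (M : smooth_manifold R m) :=
  Tensor11 {
    t11_comp :> atlas_index M -> 'rV[R]_m -> 'M[R]_m;
    t11_smooth : forall c, smooth_mx_on (img c) (t11_comp c);
    t11_trans : forall c d x, ovl c d x -> forall v : 'rV[R]_m,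
      ('D_v (trans c d) x) *m t11_comp d (trans c d x) =
      'D_(v *m t11_comp c x) (trans c d) x
  }.

Record riemannian_metric (R : realType) (m : nat) (M : smooth_manifold R m) :=
  RiemannianMetric {
    rm_comp :> atlas_index M -> 'rV[R]_m -> 'M[R]_m;
    rm_smooth : forall c, smooth_mx_on (img c) (rm_comp c);
    rm_trans : forall c d x, ovl c d x -> forall u v : 'rV[R]_m,
      bilin (rm_comp c x) u v =
      bilin (rm_comp d (trans c d x))
        ('D_u (trans c d) x) ('D_v (trans c d) x);
    rm_sym : forall c x, img c x -> forall u v : 'rV[R]_m,
      bilin (rm_comp c x) u v = bilin (rm_comp c x) v u;
    rm_pos : forall c x, img c x -> forall u : 'rV[R]_m,
      u != 0 -> 0 < bilin (rm_comp c x) u u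
  }.

(* Differential calculus on the image of a chart. Vector fields on the chart
   domain are maps from R^m to R^m, the i-th coordinate field being constant. *)
Definition coord_field (R : realType) (m : nat) (i : 'I_m) :
  'rV[R]_m -> 'rV[R]_m := fun=> delta_mx 0 i.

Definition lie_bracket (R : realType) (m : nat)
    (X Y : 'rV[R]_m -> 'rV[R]_m) : 'rV[R]_m -> 'rV[R]_m :=
  fun x => 'D_(X x) Y x - 'D_(Y x) X x.

(* (L_V a)(X) = V(a(X)) - a([V, X]) *)
Definition lie_one_form (R : realType) (m : nat) (V : 'rV[R]_m -> 'rV[R]_m)
    (a : 'rV[R]_m -> 'cV[R]_m) (X : 'rV[R]_m -> 'rV[R]_m)
    (x : 'rV[R]_m) : R :=
  'D_(V x) (fun y => pairing (a y) (X y)) x - pairing (a x) (lie_bracket V X x).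

(* (L_V G)(X, Y) = V(G(X, Y)) - G([V, X], Y) - G(X, [V, Y]) *)
Definition lie_metric (R : realType) (m : nat) (V : 'rV[R]_m -> 'rV[R]_m)
    (G : 'rV[R]_m -> 'M[R]_m) (X Y : 'rV[R]_m -> 'rV[R]_m)
    (x : 'rV[R]_m) : R :=
  'D_(V x) (fun y => bilin (G y) (X y) (Y y)) x
  - bilin (G x) (lie_bracket V X x) (Y x)
  - bilin (G x) (X x) (lie_bracket V Y x).

(* Christoffel symbol Gamma^k_ij of the Levi-Civita connection of G. *)
Definition christoffel (R : realType) (m : nat) (G : 'rV[R]_m -> 'M[R]_m)
    (x : 'rV[R]_m) (i j k : 'I_m) : R :=
  2^-1 * \sum_(l < m) (invmx (G x)) k l *
    ('D_(delta_mx 0 i) (fun y => G y j l) x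
     + 'D_(delta_mx 0 j) (fun y => G y i l) x
     - 'D_(delta_mx 0 l) (fun y => G y i j) x).

(* Covariant derivative of Y along X for the Levi-Civita connection of G. *)
Definition nabla (R : realType) (m : nat) (G : 'rV[R]_m -> 'M[R]_m)
    (X Y : 'rV[R]_m -> 'rV[R]_m) : 'rV[R]_m -> 'rV[R]_m :=
  fun x => 'D_(X x) Y x +
    \row_k \sum_(i < m) \sum_(j < m) X x 0 i * Y x 0 j * christoffel G x i j k.

(* (nabla_X P) Y = nabla_X (P Y) - P (nabla_X Y) *)
Definition nabla_tensor11 (R : realType) (m : nat) (G P : 'rV[R]_m -> 'M[R]_m)
    (X Y : 'rV[R]_m -> 'rV[R]_m) : 'rV[R]_m -> 'rV[R]_m :=
  fun x => nabla G X (fun y => Y y *m P y) x - nabla G X Y x *m P x.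

Definition curvature (R : realType) (m : nat) (G : 'rV[R]_m -> 'M[R]_m)
    (X Y Z : 'rV[R]_m -> 'rV[R]_m) : 'rV[R]_m -> 'rV[R]_m :=
  fun x => nabla G X (nabla G Y Z) x - nabla G Y (nabla G X Z) x
           - nabla G (lie_bracket X Y) Z x.

(* Ric(Y, Z) is the trace of X |-> R(X, Y)Z; given by its components in the
   coordinate frame. *)
Definition ricci (R : realType) (m : nat) (G : 'rV[R]_m -> 'M[R]_m)
    (x : 'rV[R]_m) : 'M[R]_m :=
  \matrix_(j, k) \sum_(i < m)
    curvature G (@coord_field R m i) (@coord_field R m j)
      (@coord_field R m k) x 0 i.

Definition scalar_curvature (R : realType) (m : nat)
    (G : 'rV[R]_m -> 'M[R]_m) (x : 'rV[R]_m) : R :=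
  \tr (invmx (G x) *m ricci G x).

Definition almost_contact (R : realType) (m : nat) (M : smooth_manifold R m)
    (phi : tensor11 M) (xi : vector_field M) (eta : one_form M) : Prop :=
  forall (c : atlas_index M) x, img c x ->
    (forall u : 'rV[R]_m, (u *m phi c x) *m phi c x =
                          - u + pairing (eta c x) u *: xi c x) /\
    pairing (eta c x) (xi c x) = 1.

Definition compatible_metric (R : realType) (m : nat) (M : smooth_manifold R m)
    (phi : tensor11 M) (eta : one_form M) (g : riemannian_metric M) : Prop :=
  forall (c : atlas_index M) x, img c x -> forall u v : 'rV[R]_m,
    bilin (g c x) (u *m phi c x) (v *m phi c x) =
    bilin (g c x) u v - pairing (eta c x) u * pairing (eta c x) v.

Definition almost_contact_metric (R : realType) (m : nat)
    (M : smooth_manifold R m) (phi : tensor11 M) (xi : vector_field M)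
    (eta : one_form M) (g : riemannian_metric M) : Prop :=
  almost_contact phi xi eta /\ compatible_metric phi eta g.

(* In the following definitions, X and Y range over the smooth vector fields on
   the domains of the charts of the atlas. *)
Definition kenmotsu (R : realType) (m : nat) (M : smooth_manifold R m)
    (phi : tensor11 M) (xi : vector_field M) (eta : one_form M)
    (g : riemannian_metric M) : Prop :=
  almost_contact_metric phi xi eta g /\
  forall (c : atlas_index M) (X Y : 'rV[R]_m -> 'rV[R]_m),
    smooth_mx_on (img c) X -> smooth_mx_on (img c) Y ->
    forall x, img c x ->
      nabla_tensor11 (g c) (phi c) X Y x =
      bilin (g c x) (X x *m phi c x) (Y x) *: xi c x
      - pairing (eta c x) (Y x) *: (X x *m phi c x).

Definition eta_ricci_soliton (R : realType) (m : nat) (M : smooth_manifold R m)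
    (eta : one_form M) (g : riemannian_metric M) (V : vector_field M)
    (lambda mu : R) : Prop :=
  forall (c : atlas_index M) (X Y : 'rV[R]_m -> 'rV[R]_m),
    smooth_mx_on (img c) X -> smooth_mx_on (img c) Y ->
    forall x, img c x ->
      2^-1 * lie_metric (V c) (g c) X Y x
      + bilin (ricci (g c) x) (X x) (Y x)
      + lambda * bilin (g c x) (X x) (Y x)
      + mu * (pairing (eta c x) (X x) * pairing (eta c x) (Y x)) = 0.

Definition infinitesimal_contact (R : realType) (m : nat)
    (M : smooth_manifold R m) (eta : one_form M) (V : vector_field M)
    (rho : M -> R) : Prop :=
  forall (c : atlas_index M) (X : 'rV[R]_m -> 'rV[R]_m),
    smooth_mx_on (img c) X ->
    forall x, img c x ->
      lie_one_form (V c) (eta c) X x =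
      rho (chart_inv (atlas c) x) * pairing (eta c x) (X x).

Definition einstein (R : realType) (m : nat) (M : smooth_manifold R m)
    (g : riemannian_metric M) : Prop :=
  exists k : R, forall (c : atlas_index M) x, img c x ->
    ricci (g c) x = k *: g c x.

Definition has_constant_scalar_curvature (R : realType) (m : nat)
    (M : smooth_manifold R m) (g : riemannian_metric M) (r : R) : Prop :=
  forall (c : atlas_index M) x, img c x -> scalar_curvature (g c) x = r.

(* Main.v *)
Require Import Defs.
From HB Require Import structures.
From mathcomp Require Import all_boot all_order all_algebra.
From mathcomp Require Import all_classical all_reals all_analysis.
From mathcomp Require Import ring lra.
Set Implicit Arguments.
Unset Strict Implicit.
Unset Printing Implicit Defensive.
Import Order.TTheory GRing.Theory Num.Theory.
Import numFieldNormedType.Exports.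
Local Open Scope classical_set_scope.
Local Open Scope ring_scope.

(** The theorem is local: its hypotheses and conclusions are equations in one
    chart at a time, so coordinate changes never enter. On the open image [U] of
    a chart the smooth functions form a commutative ring [A] with commuting
    derivations, the partial derivatives, and vector fields are row vectors over
    [A]. The Levi-Civita connection, its curvature and all Lie derivatives then
    become algebra over [A] ([chart_calculus]), and evaluation at a point is a
    ring morphism that carries each identity back to the chart.

    Write k = g - eta (x) eta and let m = 2n + 1 be the dimension. The Kenmotsu
    equation applied to xi gives nabla_X xi = X - eta(X) xi. Hence nabla eta = k
    is symmetric, R(X, Y) xi = eta(X) Y - eta(Y) X and Ric(X, xi) = - 2n eta(X)
    ([curv_xi], [ric_xi]). Moreover L_xi g = 2 k, and the Koszul formula for the
    Lie derivative of a connection yields (L_xi nabla)(X, Y) = - 2 k(X, Y) xi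
    ([lie_nab_xi]). Differentiating once more,
    (L_xi R)(X, Y) Z = - 2 k(Y, Z) X + 2 k(X, Z) Y, whose trace is
    L_xi Ric = - 4n k ([lie_xi_ric]).

    Now let V be the potential field. The soliton equation at (X, xi) together
    with L_V eta = rho eta gives
    g(X, [V, xi]) = (rho - 2 (2n - lambda - mu)) eta(X), whereas L_V eta at xi
    gives eta([V, xi]) = - rho. So rho = 2n - lambda - mu is constant and
    [V, xi] = - rho xi ([rhoE], [br_V_xi]). Replacing L_V g by its value in
    L_V L_xi g - L_xi L_V g = L_[V, xi] g leaves 2 Ric = - 4n g + rho k
    ([ric_kap]). Applying L_xi to this equation gives rho k = 0 ([rho_kap]).
    Since k has trace 2n, rho vanishes; hence Ric = - 2n g, and the scalar
    curvature is - 2n (2n + 1). *)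

(** * Directional and mixed partial derivatives *)

Section PartialDerivatives.
Variables (R : realType) (m : nat).
Implicit Types (f g : 'rV[R]_m -> R) (U : set 'rV[R]_m) (x y u v : 'rV[R]_m)
  (i j : 'I_m).

Lemma derive_line f y v (s : R) : derivable f (s *: v + y) v ->
  is_derive s 1 (fun t : R => f (t *: v + y)) ('D_v f (s *: v + y)).
Proof.
move=> df.
have E : (fun h : R => h^-1 *: (f (h *: v + (s *: v + y)) - f (s *: v + y))) =
  (fun h : R => h^-1 *: (((fun t : R => f (t *: v + y)) \o shift s) (h *: 1) -
     f (s *: v + y))).
  by apply/funext => h /=; rewrite [h *: 1]mulr1 scalerDl addrA.
by split; [rewrite /derivable -E|rewrite /derive -E].
Qed.

Lemma mvt_line_pos f y v (s c e : R) : 0 <= s ->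
  (forall t, 0 <= t <= s -> derivable f (t *: v + y) v /\
      `|'D_v f (t *: v + y) - c| <= e) ->
  `|f (s *: v + y) - f y - s * c| <= e * s.
Proof.
move=> s0 H.
have D t : 0 <= t <= s ->
    is_derive t 1 (fun t : R => f (t *: v + y)) ('D_v f (t *: v + y)).
  by move=> ts; apply: derive_line; case: (H t ts).
have [t ts E] : exists2 t, t \in `[0, s]%R &
    f (s *: v + y) - f (0 *: v + y) = 'D_v f (t *: v + y) * (s - 0).
  apply: (@MVT_segment R (fun t : R => f (t *: v + y))) => //.
    move=> t; rewrite in_itv /= => /andP[/ltW t0 /ltW ts].
    by apply: D; rewrite t0.
  apply: derivable_within_continuous => t; rewrite in_itv /= => ts.
  by have [] := D t ts.
move: E; rewrite scale0r add0r subr0 => ->.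
rewrite in_itv /= in ts.
rewrite (_ : _ - _ = ('D_v f (t *: v + y) - c) * s); last by ring.
by rewrite normrM (ger0_norm s0) ler_wpM2r//; case: (H t ts).
Qed.

Lemma mvt_line f y v (s c e : R) :
  (forall t, `|t| <= `|s| -> derivable f (t *: v + y) v /\
      `|'D_v f (t *: v + y) - c| <= e) ->
  `|f (s *: v + y) - f y - s * c| <= e * `|s|.
Proof.
have [s0|s0] := leP 0 s => H.
  rewrite (ger0_norm s0); apply: mvt_line_pos => // t /andP[t0 ts]; apply: H.
  by rewrite !ger0_norm.
have := @mvt_line_pos f (s *: v + y) v (- s) c e.
rewrite oppr_ge0 (ltW s0) addrA -scalerDl addNr scale0r add0r => /(_ isT) K.
rewrite distrC opprB addrCA -opprB -[s * c]opprK -mulNr.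
rewrite [`|s|]ltr0_norm//; apply: le_trans (K _).
  by rewrite le_eqVlt; apply/orP; left; apply/eqP; congr `|_|; ring.
move=> t /andP[t0 ts]; rewrite addrA -scalerDl; apply: H.
by rewrite (ltr0_norm s0) ler_norml; apply/andP; split; lra.
Qed.

Lemma near_ball_line (P : set 'rV[R]_m) x : nbhs x P ->
  exists2 r : R, 0 < r & forall y, `|y| < r -> P (y + x).
Proof.
move/nbhs_ballP => [r /= r0 H]; exists r => // y yr; apply: H.
by rewrite -ball_normE /ball_ /= opprD addrC subrK normrN.
Qed.

(** The increment along [u + t *: v] is the increment along [u] followed by one
    along [t *: v] from a moving base point; the mean value inequality compares
    the latter with the derivative at [x], by continuity of 'D_v f. *)
Lemma is_derive_add f x u v (a t : R) :
  (\near x, derivable f x v) -> {for x, continuous (fun y => 'D_v f y)} ->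
  is_derive x u f a -> is_derive x (u + t *: v) f (a + t * 'D_v f x).
Proof.
move=> dn dc du.
suff L : (fun h : R => h^-1 *: (f (h *: (u + t *: v) + x) - f x)) @ 0^' -->
    a + t * 'D_v f x.
  by split; [apply/cvg_ex; eexists; exact: L | exact: cvg_lim L].
have La : (fun h : R => h^-1 *: (f (h *: u + x) - f x)) @ 0^' --> a.
  by have [/cvg_ex[l Hl] Ha] := du; rewrite -Ha /derive (cvg_lim _ Hl).
suff Lt : (fun h : R => h^-1 *: (f (h *: (u + t *: v) + x) - f (h *: u + x)))
     @ 0^' --> t * 'D_v f x.
  have -> : (fun h : R => h^-1 *: (f (h *: (u + t *: v) + x) - f x)) =
    (fun h : R => h^-1 *: (f (h *: u + x) - f x)) +
    (fun h : R => h^-1 *: (f (h *: (u + t *: v) + x) - f (h *: u + x))).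
    by apply/funext => h; rewrite /GRing.add /= -scalerDr addrC subrKA.
  exact: cvgD.
apply/cvgrPdist_le => e e0.
pose e1 := e / (`|t| + 1).
have t1 : 0 < `|t| + 1 by rewrite ltr_pwDr.
have e10 : 0 < e1 by rewrite divr_gt0.
have [r r0 H] : exists2 r : R, 0 < r & forall y, `|y| < r ->
    derivable f (y + x) v /\ `|'D_v f (y + x) - 'D_v f x| <= e1.
  apply: (@near_ball_line (fun y => derivable f y v /\
      `|'D_v f y - 'D_v f x| <= e1)).
  apply: filterI dn _.
  move/cvgrPdist_le : dc => /(_ e1 e10); apply: filterS => y.
  by rewrite distrC.
pose q := r / (`|u| + `|t| * `|v| + 1).
have q1 : 0 < `|u| + `|t| * `|v| + 1.
  by rewrite ltr_pwDr// addr_ge0// mulr_ge0.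
have q0 : 0 < q by rewrite divr_gt0.
near=> h.
have hn0 : h != 0 by near: h; exact: nbhs_dnbhs_neq.
have hq : `|h| < q by near: h; exact: dnbhs0_lt.
have K : `|f ((h * t) *: v + (h *: u + x)) - f (h *: u + x)
    - (h * t) * 'D_v f x| <= e1 * `|h * t|.
  apply: mvt_line => s sh; rewrite addrA; apply: H.
  apply: (le_lt_trans (ler_normD _ _)); rewrite !normrZ.
  apply: (@le_lt_trans _ _ (`|h| * (`|u| + `|t| * `|v| + 1))).
    rewrite normrM in sh.
    have := ler_wpM2r (normr_ge0 v) sh.
    have := normr_ge0 h.
    by rewrite !mulrDr mulr1 mulrA; lra.
  by rewrite -lter_pdivlMr.
have -> : h *: (u + t *: v) + x = (h * t) *: v + (h *: u + x).
  by rewrite scalerDr scalerA addrCA addrA.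
have -> : t * 'D_v f x - h^-1 *: (f ((h * t) *: v + (h *: u + x)) - f (h *: u + x))
  = - (h^-1 * (f ((h * t) *: v + (h *: u + x)) - f (h *: u + x)
    - (h * t) * 'D_v f x)).
  by rewrite /GRing.scale /=; field.
rewrite normrN normrM normfV ler_pdivrMl ?normr_gt0//.
apply: (le_trans K); rewrite normrM mulrCA ler_wpM2l//.
rewrite /e1 -mulrA ler_piMr ?(ltW e0)// mulrC ler_pdivrMr// mul1r.
by rewrite lerDl.
Unshelve. all: by end_near. Qed.

Lemma Ck_onW U k f : Ck_on k.+1 U f -> Ck_on k U f.
Proof.
elim: k f => [|k IH] f [fc H]; split => // i.
by have [dH cH] := H i; split => //; apply: IH.
Qed.

Lemma Ck_on_continuous U k f : Ck_on k U f ->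
  forall x, U x -> {for x, continuous f}.
Proof. by case: k => [|k] []. Qed.

Lemma Ck_on_eq U k f g : open U -> (forall x, U x -> f x = g x) ->
  Ck_on k U f -> Ck_on k U g.
Proof.
move=> Uo fg0; have E x : U x -> \near x, f x = g x.
  by move=> Ux; near=> y; apply: fg0; near: y; exact: open_nbhs_nbhs.
elim: k f g fg0 E => [|k IH] f g fg E.
  move=> [fc _]; split => // x Ux; have fx := fc x Ux.
  rewrite /prop_for /continuous_at -(fg x Ux); apply: cvg_trans fx.
  exact: (@near_eq_cvg _ _ (nbhs x) _ f g (E x Ux)).
move=> [fc H].
split; first exact: Ck_on_continuous (IH f g fg E (Ck_onW (conj fc H))).
move=> i; have [dH cH] := H i; split.
  by move=> x Ux; apply: near_eq_derivable (dH x Ux); exact: E.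
have E' x : U x -> 'D_(delta_mx 0 i) f x = 'D_(delta_mx 0 i) g x.
  by move=> Ux; apply: near_eq_derive; exact: E.
apply: IH cH => // x Ux; near=> y; apply: E'; near: y; exact: open_nbhs_nbhs.
Unshelve. all: by end_near. Qed.

Lemma smooth_on_eq U f g : open U -> (forall x, U x -> f x = g x) ->
  smooth_on U f -> smooth_on U g.
Proof. by move=> Uo fg sf k; apply: Ck_on_eq fg (sf k). Qed.

Lemma smooth_on_continuous U f x : smooth_on U f -> U x -> {for x, continuous f}.
Proof. by move=> /(_ 0%N) sf; exact: Ck_on_continuous sf x. Qed.

Lemma smooth_on_derivable U f x i : smooth_on U f -> U x ->
  derivable f x (delta_mx 0 i).
Proof. by move=> /(_ 1%N)[_ /(_ i)[H _]] Ux; exact: H. Qed.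

Lemma smooth_on_partial U f i : smooth_on U f ->
  smooth_on U (fun x => 'D_(delta_mx 0 i) f x).
Proof. by move=> sf k; have [_ H] := sf k.+1; have [] := H i. Qed.

Lemma Ck_on_cst U k (a : R) : open U -> Ck_on k U (fun=> a).
Proof.
move=> Uo; elim: k a => [|k IH] a; split => //;
  try by move=> x _; exact: cst_continuous.
move=> i; split => [x _|]; first exact: derivable_cst.
by apply: Ck_on_eq (IH 0) => // x _; rewrite derive_cst.
Qed.

Lemma Ck_onD U k f g : open U -> Ck_on k U f -> Ck_on k U g ->
  Ck_on k U (fun x => f x + g x).
Proof.
move=> Uo; elim: k f g => [|k IH] f g [fc Hf] [gc Hg]; split => //;
  try by move=> x Ux; exact: cvgD (fc x Ux) (gc x Ux).
move=> i; have [df cf] := Hf i; have [dg cg] := Hg i; split => [x Ux|].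
  by apply: derivableD; [exact: df|exact: dg].
apply: Ck_on_eq (IH _ _ cf cg) => // x Ux; rewrite deriveD//.
  exact: df.
exact: dg.
Qed.

Lemma Ck_onN U k f : open U -> Ck_on k U f -> Ck_on k U (fun x => - f x).
Proof.
move=> Uo; elim: k f => [|k IH] f [fc Hf].
  by split => // x Ux; exact: continuousN (fc x Ux).
split; first by move=> x Ux; exact: continuousN (fc x Ux).
move=> i; have [df cf] := Hf i; split => [x Ux|].
  by apply: derivableN; exact: df.
by apply: Ck_on_eq (IH _ cf) => // x Ux; rewrite deriveN//; exact: df.
Qed.

Lemma Ck_onM U k f g : open U -> Ck_on k U f -> Ck_on k U g ->
  Ck_on k U (fun x => f x * g x).
Proof.
move=> Uo; elim: k f g => [|k IH] f g; first move=> [fc Hf] [gc Hg].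
  by split => // x Ux; exact: cvgM (fc x Ux) (gc x Ux).
move=> /[dup] /Ck_onW f1 [fc Hf] /[dup] /Ck_onW g1 [gc Hg]; split.
  by move=> x Ux; exact: cvgM (fc x Ux) (gc x Ux).
move=> i; have [df cf] := Hf i; have [dg cg] := Hg i; split => [x Ux|].
  by apply: derivableM; [exact: df|exact: dg].
apply: Ck_on_eq (Ck_onD Uo (IH _ _ f1 cg) (IH _ _ g1 cf)) => // x Ux.
by rewrite deriveM//; [exact: df|exact: dg].
Qed.

Lemma Ck_onV U k f : open U -> (forall x, U x -> f x != 0) -> Ck_on k U f ->
  Ck_on k U (fun x => (f x)^-1).
Proof.
move=> Uo f0; elim: k => [|k IH].
  by move=> [fc _]; split => // x Ux; exact: cvgV (f0 x Ux) (fc x Ux).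
move=> /[dup] /Ck_onW /IH f1 [fc Hf]; split.
  by move=> x Ux; exact: cvgV (f0 x Ux) (fc x Ux).
move=> i; have [df cf] := Hf i; split => [x Ux|].
  by apply: derivableV; [exact: f0|exact: df].
apply: Ck_on_eq (Ck_onN Uo (Ck_onM Uo (Ck_onM Uo f1 f1) cf)) => // x Ux.
rewrite deriveV//; [|exact: f0|exact: df].
by rewrite /GRing.scale /= -exprVn expr2 mulNr.
Qed.

(** Differentiability in every direction, one coordinate at a time: each
    coordinate adds its partial derivative by [is_derive_add]. *)
Lemma smooth_is_derive U f x v : open U -> smooth_on U f -> U x ->
  is_derive x v f (\sum_(i < m) v 0 i * 'D_(delta_mx 0 i) f x).
Proof.
move=> Uo sf Ux.
rewrite {1}[v]row_sum_delta.
pose S := fun (w : 'rV[R]_m) a => is_derive x w f a.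
rewrite -/(S _ _); apply: (@big_rec2 _ _ S); first exact: is_derive0.
move=> i w a _ Sw; rewrite /S (addrC _ w) (addrC _ a).
apply: is_derive_add Sw.
  near=> y; apply: (smooth_on_derivable sf); near: y; exact: open_nbhs_nbhs.
exact: (smooth_on_continuous (@smooth_on_partial _ _ i sf)).
Unshelve. all: by end_near. Qed.

Lemma is_derive_shift_arg f a y u :
  derivable f (a + y) u -> is_derive y u (fun z => f (a + z)) ('D_u f (a + y)).
Proof.
move=> df.
have E : (fun h : R => h^-1 *: (((fun z => f (a + z)) \o shift y) (h *: u) -
      f (a + y))) =
   (fun h : R => h^-1 *: (f (h *: u + (a + y)) - f (a + y))).
  by apply/funext => h /=; rewrite [a + (_ + _)]addrCA.
by split; [rewrite /derivable E|rewrite /derive E].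
Qed.

(** The mean value inequality applied twice: first along [u] to the function
    y |-> f (h v + y) - f y, whose derivative is a difference of values of
    'D_u f, and then along [v] to 'D_u f. *)
Lemma second_difference f x u v (e : R) :
  (\near x, derivable f x u) ->
  (\near x, derivable (fun y => 'D_u f y) x v) ->
  {for x, continuous (fun y => 'D_v (fun z => 'D_u f z) y)} -> 0 < e ->
  exists2 r : R, 0 < r & forall h, `|h| < r ->
    `|f (h *: v + (h *: u + x)) - f (h *: u + x) - (f (h *: v + x) - f x)
      - h * (h * 'D_v (fun z => 'D_u f z) x)| <= e * `|h| * `|h|.
Proof.
move=> d1 d2 dc e0; set c := 'D_v _ x.
have [r r0 H] : exists2 r : R, 0 < r & forall y, `|y| < r ->
    derivable f (y + x) u /\ (derivable (fun y => 'D_u f y) (y + x) v /\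
   `|'D_v (fun z => 'D_u f z) (y + x) - c| <= e).
  apply: (@near_ball_line (fun y => derivable f y u /\
    (derivable (fun y => 'D_u f y) y v /\
     `|'D_v (fun z => 'D_u f z) y - c| <= e))).
  apply: filterI d1 _; apply: filterI d2 _.
  move/cvgrPdist_le : dc => /(_ e e0); apply: filterS => y K.
  by rewrite -opprB normrN; exact: K.
have q1 : 0 < `|u| + `|v| + 1 by rewrite ltr_pwDr// addr_ge0.
exists (r / (`|u| + `|v| + 1)) => [|h hr]; first by rewrite divr_gt0.
have B s t : `|s| <= `|h| -> `|t| <= `|h| -> `|s *: v + t *: u| < r.
  move=> sh th; apply: (le_lt_trans (ler_normD _ _)); rewrite !normrZ.
  apply: (@le_lt_trans _ _ (`|h| * (`|u| + `|v| + 1))).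
    have := ler_wpM2r (normr_ge0 v) sh; have := ler_wpM2r (normr_ge0 u) th.
    by have := normr_ge0 h; rewrite !mulrDr mulr1; lra.
  by rewrite -lter_pdivlMr.
have B0 t : `|t| <= `|h| -> `|t *: u| < r.
  by move=> th; have := B 0 t; rewrite scale0r add0r normr0; apply.
apply: (@mvt_line (fun y => f (h *: v + y) - f y) x u h) => t th.
have D1 : derivable f (h *: v + (t *: u + x)) u.
  by rewrite addrA; have [] := H _ (B h t (lexx _) th).
have D2 : derivable f (t *: u + x) u by have [] := H _ (B0 t th).
have [D3 E3] := is_deriveB (is_derive_shift_arg D1) (derivableP D2).
split; first exact: D3.
rewrite [X in `|X - _|]E3.
apply: (@mvt_line (fun y => 'D_u f y) (t *: u + x) v h c e) => s sh.
by rewrite addrA; have [_] := H _ (B s t sh th).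
Qed.

(** The second difference is symmetric in [u] and [v], so both mixed derivatives
    are the limit of the same quotient. *)
Lemma derive_comm f x u v :
  (\near x, derivable f x u) -> (\near x, derivable f x v) ->
  (\near x, derivable (fun y => 'D_u f y) x v) ->
  (\near x, derivable (fun y => 'D_v f y) x u) ->
  {for x, continuous (fun y => 'D_v (fun z => 'D_u f z) y)} ->
  {for x, continuous (fun y => 'D_u (fun z => 'D_v f z) y)} ->
  'D_v (fun z => 'D_u f z) x = 'D_u (fun z => 'D_v f z) x.
Proof.
move=> du dv duv dvu cuv cvu; set a := LHS; set b := RHS.
apply/eqP; rewrite -subr_eq0 -normr_le0; apply/ler_addgt0Pr => e e0; rewrite add0r.
have e20 : 0 < e / 2 by rewrite divr_gt0.
have [r1 r10 H1] := second_difference du duv cuv e20.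
have [r2 r20 H2] := second_difference dv dvu cvu e20.
pose h := Num.min r1 r2 / 2.
have m0 : 0 < Num.min r1 r2 by rewrite lt_min r10.
have h0 : 0 < h by rewrite divr_gt0.
have hm : h < Num.min r1 r2 by rewrite /h; lra.
have /andP[hr1 hr2] : (h < r1) && (h < r2) by rewrite -lt_min.
have nh : `|h| = h by rewrite gtr0_norm.
have {}H1 := H1 h; have {}H2 := H2 h.
rewrite !nh -/a in H1; rewrite !nh -/b in H2.
have := H1 hr1; have {H2}:= H2 hr2; rewrite [h *: u + (h *: v + x)]addrCA => H2 {}H1.
have : `|h * h * (a - b)| <= e * (h * h).
  move: H1 H2; set F := f (h *: v + _) => H1 H2.
  rewrite (_ : h * h * (a - b) =
    (F - f (h *: v + x) - (f (h *: u + x) - f x) - h * (h * b))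
    - (F - f (h *: u + x) - (f (h *: v + x) - f x) - h * (h * a))); last by ring.
  by apply: (le_trans (ler_normB _ _)); apply: (le_trans (lerD H2 H1));
  rewrite (_ : e * (h * h) = e / 2 * h * h + e / 2 * h * h) //; field.
rewrite normrM gtr0_norm ?mulr_gt0// mulrC ler_pM2r// mulr_gt0//.
Qed.

Lemma smooth_partial_comm U f x i j : open U -> smooth_on U f -> U x ->
  'D_(delta_mx 0 i) (fun y => 'D_(delta_mx 0 j) f y) x =
  'D_(delta_mx 0 j) (fun y => 'D_(delta_mx 0 i) f y) x.
Proof.
move=> Uo sf Ux.
have D g k : smooth_on U g -> \near x, derivable g x (delta_mx 0 k).
  move=> sg; near=> y; apply: (smooth_on_derivable sg); near: y.
  exact: open_nbhs_nbhs.
apply: derive_comm; try (apply: D => //; exact: smooth_on_partial).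
- by apply: smooth_on_continuous Ux; do 2 apply: smooth_on_partial.
- by apply: smooth_on_continuous Ux; do 2 apply: smooth_on_partial.
Unshelve. all: by end_near. Qed.

Lemma smooth_mx_derive U a b (F : 'rV[R]_m -> 'M[R]_(a, b)) x v : open U ->
  smooth_mx_on U F -> U x ->
  'D_v F x = \matrix_(i, j) \sum_(k < m) v 0 k *
     'D_(delta_mx 0 k) (fun y => F y i j) x.
Proof.
move=> Uo sF Ux; rewrite derive_mx.
  apply/matrixP => i j; rewrite !mxE.
  by have [_ ->] := smooth_is_derive v Uo (sF i j) Ux.
apply/derivable_mxP => i j.
by have [] := smooth_is_derive v Uo (sF i j) Ux.
Qed.

End PartialDerivatives.

(** * Calculus with a torsion-free metric connection *)

(** The directional derivative, the bracket, a connection and a metric on the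
    module of vector fields, with the laws that make the connection the
    Levi-Civita connection of the metric. They are kept abstract, so that the
    entries of [nab X Y] or [br X Y] are atoms for [ring] and an identity between
    vector fields is checked entry by entry ([vring]). *)
Record levi_civita_calculus (A : comPzRingType) (m : nat) := LeviCivitaCalculus {
  der : 'rV[A]_m -> A -> A;
  br : 'rV[A]_m -> 'rV[A]_m -> 'rV[A]_m;
  nab : 'rV[A]_m -> 'rV[A]_m -> 'rV[A]_m;
  ip : 'rV[A]_m -> 'rV[A]_m -> A;
  derD : forall X a b, der X (a + b) = der X a + der X b;
  derM : forall X a b, der X (a * b) = der X a * b + a * der X b;
  derDl : forall X Y a, der (X + Y) a = der X a + der Y a;
  derZl : forall a X b, der (a *: X) b = a * der X b;
  brC : forall X Y, br X Y = - br Y X;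
  brDr : forall X Y Z, br X (Y + Z) = br X Y + br X Z;
  brZr : forall X a Y, br X (a *: Y) = der X a *: Y + a *: br X Y;
  der_br : forall X Y a, der (br X Y) a = der X (der Y a) - der Y (der X a);
  jacobi : forall X Y Z, br X (br Y Z) = br (br X Y) Z + br Y (br X Z);
  nabDl : forall X Y Z, nab (X + Y) Z = nab X Z + nab Y Z;
  nabZl : forall a X Y, nab (a *: X) Y = a *: nab X Y;
  nabDr : forall X Y Z, nab X (Y + Z) = nab X Y + nab X Z;
  nabZr : forall X a Y, nab X (a *: Y) = der X a *: Y + a *: nab X Y;
  ipC : forall X Y, ip X Y = ip Y X;
  ipDl : forall X Y Z, ip (X + Y) Z = ip X Z + ip Y Z;
  ipZl : forall a X Y, ip (a *: X) Y = a * ip X Y;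
  ip_nondeg : forall X, (forall Z, ip X Z = 0) -> X = 0;
  torsion_free : forall X Y, br X Y = nab X Y - nab Y X;
  metric_compat : forall X Y Z,
    der X (ip Y Z) = ip (nab X Y) Z + ip Y (nab X Z)
}.

Lemma eq_by_combination (A : comPzRingType) (a b c d : A) :
  c = d -> a - b = d - c -> a = b.
Proof. by move=> -> /eqP; rewrite subrr subr_eq0 => /eqP. Qed.

Ltac vring := apply/rowP => ?; rewrite !mxE; ring.

Section Calculus.
Variables (A : comPzRingType) (m : nat) (K : levi_civita_calculus A m).
Local Notation T := 'rV[A]_m.
Local Notation der := (der K).
Local Notation br := (br K).
Local Notation nab := (nab K).
Local Notation ip := (ip K).
Implicit Types (X Y Z W V : T) (a b : A).

Lemma der0 X : der X 0 = 0.
Proof. by apply: (@addrI _ (der X 0)); rewrite -derD !addr0. Qed.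

Lemma derN X a : der X (- a) = - der X a.
Proof. by apply: (@addrI _ (der X a)); rewrite -derD !subrr der0. Qed.

Lemma derB X a b : der X (a - b) = der X a - der X b.
Proof. by rewrite derD derN. Qed.

Lemma der1 X : der X 1 = 0.
Proof.
by have := derM K X 1 1; rewrite !mulr1 mul1r => /(congr1 (+%R^~ (- der X 1)));
  rewrite subrr addrK.
Qed.

Lemma der_natr X n : der X n%:R = 0.
Proof. by elim: n => [|n IH]; rewrite ?der0// -addn1 natrD derD IH der1 addr0. Qed.

Lemma brDl X Y Z : br (X + Y) Z = br X Z + br Y Z.
Proof. by rewrite brC brDr [br Z X]brC [br Z Y]brC opprD !opprK. Qed.

Lemma brZl a X Y : br (a *: X) Y = a *: br X Y - der Y a *: X.
Proof. by rewrite brC brZr [br Y X]brC; vring. Qed.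

Lemma nabNl X Y : nab (- X) Y = - nab X Y.
Proof. by rewrite -scaleN1r nabZl scaleN1r. Qed.

Lemma nabNr X Y : nab X (- Y) = - nab X Y.
Proof. by rewrite -scaleN1r nabZr derN der1 oppr0 scale0r add0r scaleN1r. Qed.

Lemma ipDr X Y Z : ip X (Y + Z) = ip X Y + ip X Z.
Proof. by rewrite ipC ipDl ![ip X _]ipC. Qed.

Lemma ipZr a X Y : ip X (a *: Y) = a * ip X Y.
Proof. by rewrite ipC ipZl [ip X _]ipC. Qed.

Lemma ipNl X Y : ip (- X) Y = - ip X Y.
Proof. by rewrite -scaleN1r ipZl mulN1r. Qed.

Lemma ipNr X Y : ip X (- Y) = - ip X Y.
Proof. by rewrite -scaleN1r ipZr mulN1r. Qed.

Lemma ip_inj X Y : (forall Z, ip X Z = ip Y Z) -> X = Y.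
Proof.
move=> H; apply/eqP; rewrite -subr_eq0; apply/eqP/(@ip_nondeg _ _ K) => Z.
by rewrite ipDl ipNl H subrr.
Qed.

Definition ipE := (ipDl, ipDr, ipZl, ipZr, ipNl, ipNr).
Definition nabE := (nabDl, nabDr, nabZl, nabZr, nabNl, nabNr).

Definition curv X Y Z := nab X (nab Y Z) - nab Y (nab X Z) - nab (br X Y) Z.

Lemma curvDl X X' Y Z : curv (X + X') Y Z = curv X Y Z + curv X' Y Z.
Proof. by rewrite /curv brDl !nabE; vring. Qed.

Lemma curvZl a X Y Z : curv (a *: X) Y Z = a *: curv X Y Z.
Proof. by rewrite /curv brZl !nabE; vring. Qed.

Lemma curvC X Y Z : curv X Y Z = - curv Y X Z.
Proof. by rewrite /curv (brC K X) nabNl; vring. Qed.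

Lemma curvDm X Y Y' Z : curv X (Y + Y') Z = curv X Y Z + curv X Y' Z.
Proof. by rewrite curvC curvDl !(curvC X); vring. Qed.

Lemma curvZm a X Y Z : curv X (a *: Y) Z = a *: curv X Y Z.
Proof. by rewrite curvC curvZl !(curvC X); vring. Qed.

Lemma curvDr X Y Z Z' : curv X Y (Z + Z') = curv X Y Z + curv X Y Z'.
Proof. by rewrite /curv !nabE; vring. Qed.

Lemma curvZr a X Y Z : curv X Y (a *: Z) = a *: curv X Y Z.
Proof. by rewrite /curv !nabE der_br; vring. Qed.

Definition trace (f : T -> T) : A := \sum_i f (delta_mx 0 i) 0 i.

Definition ric Y Z := trace (fun X => curv X Y Z).

Lemma eq_trace f g : f =1 g -> trace f = trace g.
Proof. by move=> fg; apply: eq_bigr => i _; rewrite fg. Qed.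

Lemma traceD f g : trace (fun X => f X + g X) = trace f + trace g.
Proof. by rewrite -big_split; apply: eq_bigr => i _; rewrite mxE. Qed.

Lemma traceZ a f : trace (fun X => a *: f X) = a * trace f.
Proof. by rewrite mulr_sumr; apply: eq_bigr => i _; rewrite mxE. Qed.

Lemma trace_id : trace id = m%:R.
Proof.
rewrite /trace -[m in RHS]card_ord -sumr_const; apply: eq_bigr => i _.
by rewrite mxE !eqxx.
Qed.

Lemma lin_expand (f : T -> A) : (forall X Y, f (X + Y) = f X + f Y) ->
  (forall a X, f (a *: X) = a * f X) ->
  forall X, \sum_i X 0 i * f (delta_mx 0 i) = f X.
Proof.
move=> fD fZ X; rewrite {2}[X]row_sum_delta.
have f0 : f 0 = 0 by rewrite -(scale0r 0) fZ mul0r.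
by rewrite (big_morph f fD f0); apply: eq_bigr => i _; rewrite fZ.
Qed.

Lemma trace_rank1 (f : T -> A) Y : (forall X Y, f (X + Y) = f X + f Y) ->
  (forall a X, f (a *: X) = a * f X) -> trace (fun X => f X *: Y) = f Y.
Proof.
move=> fD fZ; rewrite -[RHS](lin_expand fD fZ); apply: eq_bigr => i _.
by rewrite mxE mulrC.
Qed.

Lemma ricDl Y Y' Z : ric (Y + Y') Z = ric Y Z + ric Y' Z.
Proof. by rewrite -traceD; apply: eq_trace => X; rewrite curvDm. Qed.

Lemma ricZl a Y Z : ric (a *: Y) Z = a * ric Y Z.
Proof. by rewrite -traceZ; apply: eq_trace => X; rewrite curvZm. Qed.

Lemma ricDr Y Z Z' : ric Y (Z + Z') = ric Y Z + ric Y Z'.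
Proof. by rewrite -traceD; apply: eq_trace => X; rewrite curvDr. Qed.

Lemma ricZr a Y Z : ric Y (a *: Z) = a * ric Y Z.
Proof. by rewrite -traceZ; apply: eq_trace => X; rewrite curvZr. Qed.

Definition ric_mx : 'M[A]_m := \matrix_(j, k) ric (delta_mx 0 j) (delta_mx 0 k).

Lemma ric_mxE Y Z : (Y *m ric_mx *m Z^T) 0 0 = ric Y Z.
Proof.
rewrite -(lin_expand (f := ric Y) (ricDr Y) (fun a => ricZr a Y) Z) mxE.
apply: eq_bigr => k _; rewrite !mxE mulrC; congr (_ * _).
rewrite -(lin_expand (f := fun Y => ric Y _) (fun Y Y' => ricDl Y Y' _)
  (fun a Y => ricZl a Y _) Y).
by apply: eq_bigr => j _; rewrite mxE.
Qed.

Definition lie V (B : T -> T -> A) X Y :=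
  der V (B X Y) - B (br V X) Y - B X (br V Y).

(** Expanding [br V] in the coordinate frame produces, besides the derivative of
    the diagonal entries of [f], the trace of the commutator of the matrix of [f]
    with the matrix of the brackets of [V] with the frame, which is zero. *)
Lemma trace_lie V (f : T -> T) : (forall X Y, f (X + Y) = f X + f Y) ->
  (forall a X, f (a *: X) = a *: f X) ->
  trace (fun X => br V (f X) - f (br V X)) = der V (trace f).
Proof.
move=> fD fZ.
have f0 : f 0 = 0 by have := fZ 0 0; rewrite !scale0r.
have fE X : f X = \sum_l X 0 l *: f (delta_mx 0 l).
  rewrite {1}[X]row_sum_delta (big_morph f fD f0).
  by apply: eq_bigr => i _; rewrite fZ.
have brE X : br V X = \sum_l (der V (X 0 l) *: delta_mx 0 l
                               + X 0 l *: br V (delta_mx 0 l)).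
  rewrite {1}[X]row_sum_delta (big_morph (br V) (id1 := 0) (op1 := +%R)).
  - by apply: eq_bigr => l _; rewrite brZr.
  - by move=> Y Z; rewrite brDr.
  - by have := brZr K V 0 0; rewrite der0 !scale0r addr0.
rewrite /trace (big_morph (der V) (derD K V) (der0 V)).
pose e i : T := delta_mx 0 i.
transitivity (\sum_i (der V (f (e i) 0 i) +
   (\sum_l f (e i) 0 l * br V (e l) 0 i - \sum_l br V (e i) 0 l * f (e l) 0 i))).
  apply: eq_bigr => i _; rewrite mxE brE [f (br _ _)]fE [in X in _ + X]mxE.
  rewrite !summxE addrA; congr (_ - _); last by apply: eq_bigr => l _; rewrite mxE.
  rewrite (eq_bigr (fun l => der V (f (e i) 0 l) * e l 0 i +
     f (e i) 0 l * br V (e l) 0 i)); last by move=> l _; rewrite !mxE.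
  rewrite big_split /=; congr (_ + _).
  rewrite (bigD1 i)//= [e i 0 i]mxE !eqxx mulr1 big1 ?addr0// => l li.
  by rewrite mxE eqxx /= eq_sym (negbTE li) mulr0.
rewrite big_split /= [X in _ + X](_ : _ = 0) ?addr0//.
rewrite sumrB [X in _ - X]exchange_big /= -sumrB big1// => i _.
by rewrite -sumrB big1// => l _; rewrite mulrC subrr.
Qed.

Lemma lie_ric V Y Z : lie V ric Y Z =
  trace (fun X => br V (curv X Y Z) - curv (br V X) Y Z
     - curv X (br V Y) Z - curv X Y (br V Z)).
Proof.
rewrite /lie {1}/ric -trace_lie; first last.
- by move=> a X; rewrite curvZl.
- by move=> X X'; rewrite curvDl.
have traceN f : trace (fun X => - f X) = - trace f.
  by rewrite -mulN1r -traceZ; apply: eq_trace => X; rewrite scaleN1r.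
by rewrite -!traceN -!traceD.
Qed.

Definition lie_nab V X Y := br V (nab X Y) - nab (br V X) Y - nab X (br V Y).

(** Moving [br V] through the covariant derivatives in [curv] leaves one term in
    [lie_nab V] for each of them; the remaining terms cancel by the Jacobi
    identity. *)
Lemma lie_curv V X Y Z :
  br V (curv X Y Z) - curv (br V X) Y Z - curv X (br V Y) Z - curv X Y (br V Z)
  = lie_nab V X (nab Y Z) + nab X (lie_nab V Y Z) - lie_nab V Y (nab X Z)
    - nab Y (lie_nab V X Z) - lie_nab V (br X Y) Z.
Proof.
have brNr U W : br U (- W) = - br U W.
  by rewrite -scaleN1r brZr derN der1 oppr0 scale0r add0r scaleN1r.
by rewrite /lie_nab /curv !brDr !brNr (jacobi K V X Y) !nabE; vring.
Qed.

(** Both the torsion, which vanishes, and the bracket are preserved by [br V]. *)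
Lemma lie_nabC V X Y : lie_nab V X Y = lie_nab V Y X.
Proof.
have E U W : nab U W = nab W U + br U W.
  by rewrite (torsion_free K U W); vring.
rewrite /lie_nab (E X Y) (E (br V X) Y) (E X (br V Y)) brDr jacobi; vring.
Qed.

Definition nab_form (B : T -> T -> A) X Y Z :=
  der X (B Y Z) - B (nab X Y) Z - B Y (nab X Z).

(** Metric compatibility differentiated along [V]. *)
Lemma lie_nab_ip V X Y Z :
  ip (lie_nab V X Y) Z + ip Y (lie_nab V X Z) = nab_form (lie V ip) X Y Z.
Proof.
have L U W : der V (ip U W) = lie V ip U W + ip (br V U) W + ip U (br V W).
  by rewrite /lie; ring.
rewrite /nab_form /lie_nab; move: (lie V ip) L => h L.
have := der_br K V X (ip Y Z).
rewrite (L Y Z) !derD !metric_compat !derD !L !ipE => E.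
by apply: (eq_by_combination E); ring.
Qed.

(** The permutation argument behind the Koszul formula: [lie_nab V] is symmetric,
    and the sum over exchanging its last two slots is known. *)
Lemma lie_nab_koszul V X Y Z :
  ip (lie_nab V X Y) Z *+ 2 = nab_form (lie V ip) X Y Z +
    nab_form (lie V ip) Y X Z - nab_form (lie V ip) Z X Y.
Proof.
rewrite -!lie_nab_ip (lie_nabC V Y X) (lie_nabC V Z X) (lie_nabC V Z Y).
by rewrite [ip Y _]ipC [ip X _]ipC; ring.
Qed.

Lemma lie_comm V W (B : T -> T -> A) X Y :
  (forall Y X X', B (X + X') Y = B X Y + B X' Y) ->
  (forall X Y Y', B X (Y + Y') = B X Y + B X Y') ->
  lie V (lie W B) X Y - lie W (lie V B) X Y = lie (br V W) B X Y.
Proof.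
move=> Bl Br; have J U : br (br V W) U = br V (br W U) - br W (br V U).
  by rewrite (jacobi K V W U); vring.
have N1 U U' : B (- U) U' = - B U U'.
  apply: (@addrI _ (B U U')); rewrite -Bl !subrr.
  by apply: (@addrI _ (B U U')); rewrite -Bl !addr0.
have N2 U U' : B U (- U') = - B U U'.
  apply: (@addrI _ (B U U')); rewrite -Br !subrr.
  by apply: (@addrI _ (B U U')); rewrite -Br !addr0.
by rewrite /lie !J !Bl !Br !N1 !N2 !derB der_br; ring.
Qed.

End Calculus.

(** * Kenmotsu geometry and the soliton equation *)

Section Kenmotsu.
Variables (A : comPzRingType) (m : nat) (K : levi_civita_calculus A m).
Variables (half : A) (halfE : half * 2%:R = 1).
Variable xi : 'rV[A]_m.
Hypotheses (xi_unit : ip K xi xi = 1)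
  (nab_xi : forall X, nab K X xi = X - ip K X xi *: xi).
Local Notation T := 'rV[A]_m.
Local Notation der := (der K).
Local Notation br := (br K).
Local Notation nab := (nab K).
Local Notation ip := (ip K).
Implicit Types (X Y Z W V : T) (a b : A).

Lemma two_inj a b : 2%:R * a = 2%:R * b -> a = b.
Proof. by move/(congr1 ( *%R half)); rewrite !mulrA halfE !mul1r. Qed.

Definition reeb_form X := ip X xi.
Local Notation eta := reeb_form.
(** The metric transverse to [xi], which is also the covariant derivative of
    [eta]. *)
Definition kap X Y := ip X Y - eta X * eta Y.

Lemma etaD X Y : eta (X + Y) = eta X + eta Y. Proof. exact: ipDl. Qed.
Lemma etaZ a X : eta (a *: X) = a * eta X. Proof. exact: ipZl. Qed.
Lemma etaN X : eta (- X) = - eta X. Proof. exact: ipNl. Qed.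
Lemma eta_xi : eta xi = 1. Proof. exact: xi_unit. Qed.
Definition etaE := (etaD, etaZ, etaN, eta_xi).

Lemma kapC X Y : kap X Y = kap Y X.
Proof. by rewrite /kap ipC mulrC. Qed.

Lemma der_eta X Y : der X (eta Y) = eta (nab X Y) + kap X Y.
Proof. by rewrite /eta metric_compat nab_xi !ipE /kap /eta (ipC K Y X); ring. Qed.

Lemma nab_form_kap X Y Z :
  nab_form K kap X Y Z = - (kap X Y * eta Z + eta Y * kap X Z).
Proof.
have D : der X (ip Y Z - eta Y * eta Z) =
    der X (ip Y Z) - (der X (eta Y) * eta Z + eta Y * der X (eta Z)).
  by rewrite derD derN derM.
by rewrite /nab_form /kap D metric_compat !der_eta /kap; ring.
Qed.

Lemma curv_xi X Y : curv K X Y xi = eta X *: Y - eta Y *: X.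
Proof.
rewrite /curv !nab_xi -!/(eta _) !nabE !nab_xi -!/(eta _) !der_eta.
rewrite torsion_free etaD etaN (kapC Y X); vring.
Qed.

Lemma ric_xi Y : ric K Y xi = - ((m%:R - 1) * eta Y).
Proof.
rewrite /ric (eq_trace (g := fun X => eta X *: Y + (- eta Y) *: X)).
  by rewrite traceD traceZ trace_id trace_rank1; [ring|exact: etaD|exact: etaZ].
by move=> X; rewrite curv_xi; vring.
Qed.

Lemma br_xi X : br xi X = nab xi X - X + eta X *: xi.
Proof. by rewrite torsion_free nab_xi /eta; vring. Qed.

Lemma lie_xi_eta X : der xi (eta X) = eta (br xi X).
Proof. by rewrite der_eta br_xi /kap !etaE -!/(eta _) /eta (ipC _ xi); ring. Qed.

Lemma lie_xi_ip X Y : lie K xi ip X Y = 2%:R * kap X Y.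
Proof.
by rewrite /lie metric_compat !br_xi !ipE /kap /eta [ip xi Y]ipC; ring.
Qed.

Lemma lie_xi_kap X Y : lie K xi kap X Y = 2%:R * kap X Y.
Proof.
have := lie_xi_ip X Y; rewrite /lie {2 4 5}/kap !derB !derM !lie_xi_eta => E.
by apply: (eq_by_combination (esym E)); rewrite /kap; ring.
Qed.

Lemma lie_nab_xi X Y : lie_nab K xi X Y = - (2%:R * kap X Y) *: xi.
Proof.
apply: (@ip_inj _ _ K) => Z; apply: two_inj.
rewrite [LHS]mulrC mulr_natr lie_nab_koszul.
have E U W Z' : nab_form K (lie K xi ip) U W Z' =
    2%:R * nab_form K kap U W Z'.
  by rewrite /nab_form !lie_xi_ip derM der_natr; ring.
rewrite !E !nab_form_kap ipZl -/(eta _) (kapC Y X) (kapC Z X) (kapC Z Y) /eta ipC.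
by ring.
Qed.

Lemma lie_xi_curv X Y Z :
  br xi (curv K X Y Z) - curv K (br xi X) Y Z - curv K X (br xi Y) Z
    - curv K X Y (br xi Z) = (- 2%:R * kap Y Z) *: X + (2%:R * kap X Z) *: Y.
Proof.
rewrite lie_curv !lie_nab_xi !nabE !nab_xi -!/(eta _) !derN !derM !der_natr.
have := nab_form_kap X Y Z; have := nab_form_kap Y X Z; rewrite /nab_form.
have B : kap (br X Y) Z = kap (nab X Y) Z - kap (nab Y X) Z.
  by rewrite /kap torsion_free !ipE !etaE; ring.
move=> E1 E2; apply/rowP => i; rewrite !mxE B (kapC Y (nab X Z)).
have -> : der X (kap Y Z) = kap (nab X Y) Z + kap Y (nab X Z)
   - (kap X Y * eta Z + eta Y * kap X Z) by rewrite -E2; ring.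
have -> : der Y (kap X Z) = kap (nab Y X) Z + kap X (nab Y Z)
   - (kap Y X * eta Z + eta X * kap Y Z) by rewrite -E1; ring.
by rewrite (kapC Y X) (kapC Y (nab X Z)); ring.
Qed.

(** Tracing the Lie derivative of the curvature takes the place of the contracted
    second Bianchi identity. *)
Lemma lie_xi_ric Y Z : lie K xi (ric K) Y Z = - (2%:R * (m%:R - 1) * kap Y Z).
Proof.
rewrite lie_ric (eq_trace (g := fun X => (- 2%:R * kap Y Z) *: X +
   (2%:R * kap X Z) *: Y)); last by move=> X; rewrite lie_xi_curv.
rewrite traceD traceZ trace_id (trace_rank1 (f := fun X => 2%:R * kap X Z)).
- by ring.
- by move=> X X'; rewrite /kap !ipE !etaE; ring.
- by move=> a X; rewrite /kap !ipE !etaE; ring.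
Qed.

Section Soliton.
Variables (V : T) (rho lambda mu : A).
Hypothesis const_lambda : forall X, der X lambda = 0.
Hypothesis const_mu : forall X, der X mu = 0.
Hypothesis soliton : forall X Y, lie K V ip X Y =
  - (2%:R * (ric K X Y + lambda * ip X Y + mu * (eta X * eta Y))).
Hypothesis contact : forall X, der V (eta X) - eta (br V X) = rho * eta X.

(** The soliton equation on the pair [X], [xi], where [ric X xi] is known and the
    contact condition evaluates the derivative of [eta X]. *)
Lemma ip_br_V_xi X :
  ip X (br V xi) = (rho - 2%:R * (m%:R - 1 - lambda - mu)) * eta X.
Proof.
have D : der V (eta X) = eta (br V X) + rho * eta X by rewrite -contact; ring.
have := soliton X xi; rewrite ric_xi /lie -!/(eta _) eta_xi D => E.
by apply: (eq_by_combination E); ring.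
Qed.

(** Two values of eta([V, xi]): the previous lemma at [xi], and the contact
    condition at [xi], where [eta xi = 1] is constant. *)
Lemma rhoE : rho = m%:R - 1 - lambda - mu.
Proof.
apply: two_inj; have := contact xi.
rewrite /eta ipC ip_br_V_xi xi_unit der1 /eta xi_unit mulr1 => E.
by apply: (eq_by_combination E); ring.
Qed.

Lemma der_rho X : der X rho = 0.
Proof. by rewrite rhoE !derB const_lambda const_mu der_natr der1; ring. Qed.

Lemma br_V_xi : br V xi = - rho *: xi.
Proof.
apply: (@ip_inj _ _ K) => Z; rewrite [LHS]ipC ip_br_V_xi -rhoE ipZl.
by rewrite (ipC K xi) -/(eta Z); ring.
Qed.

Lemma lie_scale_const a (B : T -> T -> A) X Y : (forall X, der X a = 0) ->
  (forall X Y, B (a *: X) Y = a * B X Y) -> (forall X Y, B X (a *: Y) = a * B X Y) ->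
  lie K (a *: xi) B X Y = a * lie K xi B X Y.
Proof.
by move=> a0 Bl Br; rewrite /lie derZl !brZl !a0 !scale0r !subr0 Bl Br; ring.
Qed.

(** The identity L_V L_xi g - L_xi L_V g = L_[V, xi] g, in which L_xi g = 2 [kap],
    L_V g is given by the soliton equation and [V, xi] is a constant multiple of
    [xi]. *)
Lemma ric_kap X Y : 2%:R * ric K X Y =
  - (2%:R * (m%:R - 1)) * ip X Y + rho * kap X Y.
Proof.
have := @lie_comm _ _ K V xi ip X Y.
have L : lie K V (lie K xi ip) X Y =
    2%:R * (lie K V ip X Y - 2%:R * rho * (eta X * eta Y)).
  rewrite {1}/lie !lie_xi_ip /kap.
  have C Z : der V (eta Z) = eta (br V Z) + rho * eta Z.
    by rewrite -contact; ring.
  by rewrite derM der_natr derB derM !C /lie; ring.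
have L2 : lie K xi (lie K V ip) X Y =
  - (2%:R * (lie K xi (ric K) X Y + lambda * lie K xi ip X Y)).
  rewrite {1}/lie !soliton derN derM der_natr !derD !derM const_lambda const_mu.
  by rewrite !lie_xi_eta /lie; ring.
rewrite L L2 br_V_xi lie_scale_const => [|Z|Z W|Z W]; first last.
- by rewrite ipZr.
- by rewrite ipZl.
- by rewrite derN der_rho oppr0.
rewrite soliton !lie_xi_ip lie_xi_ric => E.
apply: two_inj.
have {}E := E (fun Y X X' => ipDl K X X' Y) (fun X Y Y' => ipDr K X Y Y').
apply: (eq_by_combination E).
have -> : lambda = m%:R - 1 - mu - rho by rewrite rhoE; ring.
by rewrite /kap; ring.
Qed.

(** The Lie derivative along [xi] of both sides of [ric_kap]: the Ricci side and
    the metric side agree by [lie_xi_ric] and [lie_xi_ip], which leaves the term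
    in [rho]. *)
Lemma rho_kap X Y : rho * kap X Y = 0.
Proof.
have E : lie K xi (fun X Y => 2%:R * ric K X Y) X Y =
  lie K xi (fun X Y => - (2%:R * (m%:R - 1)) * ip X Y + rho * kap X Y) X Y.
  by rewrite /lie !ric_kap.
apply: two_inj.
have E1 : lie K xi (fun X Y => 2%:R * ric K X Y) X Y = 2%:R * lie K xi (ric K) X Y.
  by rewrite /lie derM der_natr; ring.
have E2 : lie K xi (fun X Y => - (2%:R * (m%:R - 1)) * ip X Y + rho * kap X Y) X Y =
   - (2%:R * (m%:R - 1)) * lie K xi ip X Y + rho * lie K xi kap X Y.
  rewrite /lie derD !derM derN derM derB !der_natr der1 der_rho; ring.
move: E; rewrite E1 E2 lie_xi_ric lie_xi_ip lie_xi_kap => E.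
by apply: (eq_by_combination E); ring.
Qed.

Lemma ric_einstein X Y : ric K X Y = - (m%:R - 1) * ip X Y.
Proof. by apply: two_inj; rewrite ric_kap rho_kap; ring. Qed.

End Soliton.
End Kenmotsu.

(** * The Levi-Civita connection in coordinates *)

Section Coordinates.
Variables (A : comPzRingType) (m : nat) (d : 'I_m -> A -> A).
Hypothesis dD : forall i a b, d i (a + b) = d i a + d i b.
Hypothesis dM : forall i a b, d i (a * b) = d i a * b + a * d i b.
Hypothesis dC : forall i j a, d i (d j a) = d j (d i a).
Local Notation T := 'rV[A]_m.
Implicit Types (X Y Z W V : T) (a b : A).

Definition cder X a := \sum_i X 0 i * d i a.
Definition cderv X p q (F : 'M[A]_(p, q)) : 'M[A]_(p, q) := map_mx (cder X) F.
Definition cbr X Y := cderv X Y - cderv Y X.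

Lemma cderD X a b : cder X (a + b) = cder X a + cder X b.
Proof. by rewrite -big_split; apply: eq_bigr => i _; rewrite dD mulrDr. Qed.

Lemma cderM X a b : cder X (a * b) = cder X a * b + a * cder X b.
Proof.
rewrite mulr_suml mulr_sumr -big_split; apply: eq_bigr => i _ /=.
by rewrite dM; ring.
Qed.

Lemma cderDl X Y a : cder (X + Y) a = cder X a + cder Y a.
Proof. by rewrite -big_split; apply: eq_bigr => i _; rewrite mxE mulrDl. Qed.

Lemma cderZl a X b : cder (a *: X) b = a * cder X b.
Proof. by rewrite mulr_sumr; apply: eq_bigr => i _; rewrite mxE mulrA. Qed.

Lemma cder0 X : cder X 0 = 0.
Proof. by apply: (@addrI _ (cder X 0)); rewrite -cderD !addr0. Qed.

Lemma cderN X a : cder X (- a) = - cder X a.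
Proof. by apply: (@addrI _ (cder X a)); rewrite -cderD !subrr cder0. Qed.

Lemma cderNl X a : cder (- X) a = - cder X a.
Proof. by rewrite -scaleN1r cderZl mulN1r. Qed.

Lemma cder_sum X I (r : seq I) (P : pred I) (f : I -> A) :
  cder X (\sum_(i <- r | P i) f i) = \sum_(i <- r | P i) cder X (f i).
Proof. exact: (big_morph (cder X) (cderD X) (cder0 X)). Qed.

Lemma cder_cbr X Y a : cder (cbr X Y) a = cder X (cder Y a) - cder Y (cder X a).
Proof.
have E U W : cder U (cder W a) = cder (cderv U W) a +
    \sum_i \sum_j U 0 i * W 0 j * d i (d j a).
  transitivity (\sum_j cder U (W 0 j * d j a)); first by rewrite -cder_sum.
  rewrite [X in _ = _ + X]exchange_big -big_split; apply: eq_bigr => j _ /=.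
  rewrite cderM mxE; congr (_ + _); rewrite mulr_sumr.
  by apply: eq_bigr => i _; ring.
rewrite cderDl cderNl !E.
have -> : \sum_i \sum_j X 0 i * Y 0 j * d i (d j a) =
    \sum_i \sum_j Y 0 i * X 0 j * d i (d j a).
  rewrite exchange_big; apply: eq_bigr => i _; apply: eq_bigr => j _.
  by rewrite dC; ring.
by ring.
Qed.

Lemma cderv_mul X p q r (P : 'M[A]_(p, q)) (Q : 'M[A]_(q, r)) :
  cderv X (P *m Q) = cderv X P *m Q + P *m cderv X Q.
Proof.
apply/matrixP => i j; rewrite !mxE cder_sum -big_split; apply: eq_bigr => k _ /=.
by rewrite cderM !mxE.
Qed.

Lemma cderv_tr X p q (P : 'M[A]_(p, q)) : cderv X P^T = (cderv X P)^T.
Proof. by apply/matrixP => i j; rewrite !mxE. Qed.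

Lemma cbrC X Y : cbr X Y = - cbr Y X.
Proof. by rewrite /cbr opprB. Qed.

Lemma cbrDr X Y Z : cbr X (Y + Z) = cbr X Y + cbr X Z.
Proof. by apply/rowP => i; rewrite !mxE cderD cderDl; ring. Qed.

Lemma cbrZr X a Y : cbr X (a *: Y) = cder X a *: Y + a *: cbr X Y.
Proof. by apply/rowP => i; rewrite !mxE cderM cderZl; ring. Qed.

Lemma cjacobi X Y Z : cbr X (cbr Y Z) = cbr (cbr X Y) Z + cbr Y (cbr X Z).
Proof.
have E U W i : cbr U W 0 i = cder U (W 0 i) - cder W (U 0 i) by rewrite !mxE.
apply/rowP => i; rewrite !(E, mxE) !cderD !cderN !cder_cbr; ring.
Qed.

Variables (half : A) (G H : 'M[A]_m).
Hypothesis half2 : half * 2%:R = 1.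
Hypothesis symG : G^T = G.
Hypothesis mulGH : G *m H = 1%:M.

Definition cip X Y := (X *m G *m Y^T) 0 0.

Definition lowered_christoffel i j l := d i (G j l) + d j (G i l) - d l (G i j).

Definition cchristoffel i j k := half * \sum_l H k l * lowered_christoffel i j l.

Definition cnab X Y : T := cderv X Y +
  \row_k \sum_i \sum_j X 0 i * Y 0 j * cchristoffel i j k.

(** The connection form, through which metric compatibility becomes the matrix
    identity [cderv_metric]. *)
Definition conn_mx X : 'M[A]_m := \matrix_(j, k) \sum_i X 0 i * cchristoffel i j k.

Lemma cnabE X Y : cnab X Y = cderv X Y + Y *m conn_mx X.
Proof.
congr (_ + _); apply/rowP => k; rewrite !mxE exchange_big; apply: eq_bigr => j _.
by rewrite mxE mulr_sumr; apply: eq_bigr => i _; ring.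
Qed.

(** Multiplying by the metric cancels the inverse metric in the Christoffel
    symbols. *)
Lemma conn_mxG X j l : (conn_mx X *m G) j l =
  half * \sum_i X 0 i * lowered_christoffel i j l.
Proof.
have L i : \sum_k cchristoffel i j k * G k l = half * lowered_christoffel i j l.
  have HG p : \sum_k H k p * G k l = (l == p)%:R.
    have := congr1 (fun B : 'M[A]_m => B l p) mulGH; rewrite !mxE => <-.
    by apply: eq_bigr => k _; rewrite -[in RHS]symG mxE mulrC.
  rewrite (eq_bigr (fun k =>
    half * \sum_p lowered_christoffel i j p * (H k p * G k l))).
    rewrite -mulr_sumr exchange_big /=; congr (_ * _).
    under eq_bigr => p _ do rewrite -mulr_sumr HG.
    rewrite (bigD1 l)//= eqxx mulr1 big1 ?addr0// => p pl.
    by rewrite eq_sym (negbTE pl) mulr0.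
  move=> k _; rewrite /cchristoffel -mulrA mulr_suml; congr (_ * _).
  by apply: eq_bigr => p _; ring.
rewrite mxE mulr_sumr.
under eq_bigr do rewrite mxE mulr_suml.
rewrite exchange_big /=; apply: eq_bigr => i _.
under eq_bigr do rewrite -mulrA.
by rewrite -mulr_sumr L; ring.
Qed.

(** The metric is parallel: symmetrising the lowered Christoffel symbols in the
    last two indices leaves the derivative of the metric. *)
Lemma cderv_metric X : cderv X G = conn_mx X *m G + (conn_mx X *m G)^T.
Proof.
apply/matrixP => j l; rewrite [RHS]mxE [_^T _ _]mxE !conn_mxG -mulrDr -big_split /=.
rewrite !mxE mulr_sumr; apply: eq_bigr => i _.
have GC p q : G p q = G q p by rewrite -{1}symG mxE.
rewrite /lowered_christoffel (GC l j).
by rewrite -[LHS]mul1r -half2; ring.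
Qed.

Lemma cipC X Y : cip X Y = cip Y X.
Proof.
rewrite /cip; have -> : Y *m G *m X^T = (X *m G *m Y^T)^T.
  by rewrite !trmx_mul trmxK symG mulmxA.
by rewrite [RHS]mxE.
Qed.

Lemma ctorsion X Y : cbr X Y = cnab X Y - cnab Y X.
Proof.
have GC p q : G p q = G q p by rewrite -{1}symG mxE.
have C i j k : cchristoffel i j k = cchristoffel j i k.
  congr (_ * _); apply: eq_bigr => l _; congr (_ * _).
  by rewrite /lowered_christoffel (GC i j); ring.
apply/rowP => k; rewrite /cbr !mxE.
have -> : \sum_i \sum_j X 0 i * Y 0 j * cchristoffel i j k =
   \sum_i \sum_j Y 0 i * X 0 j * cchristoffel i j k.
  rewrite exchange_big; apply: eq_bigr => i _; apply: eq_bigr => j _.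
  by rewrite (C j i); ring.
by ring.
Qed.

Lemma cmetric X Y Z : cder X (cip Y Z) = cip (cnab X Y) Z + cip Y (cnab X Z).
Proof.
have -> : cder X (cip Y Z) = cderv X (Y *m G *m Z^T) 0 0 by rewrite mxE.
rewrite !cderv_mul cderv_tr cderv_metric /cip !cnabE.
rewrite [(_ + _)^T]linearD /= trmx_mul trmx_mul symG.
have aD (P Q : 'M[A]_1) : (P + Q) 0 0 = P 0 0 + Q 0 0 by rewrite mxE.
rewrite !(mulmxDl, mulmxDr) !mulmxA !aD; ring.
Qed.

Lemma cip_nondeg X : (forall Z, cip X Z = 0) -> X = 0.
Proof.
move=> X0; have XG : X *m G = 0.
  apply/rowP => j; have := X0 (delta_mx 0 j); rewrite /cip trmx_delta.
  by rewrite -colE !mxE.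
by rewrite -[X]mulmx1 -mulGH mulmxA XG mul0mx.
Qed.

Lemma cnabDl X Y Z : cnab (X + Y) Z = cnab X Z + cnab Y Z.
Proof.
rewrite !cnabE.
have -> : conn_mx (X + Y) = conn_mx X + conn_mx Y.
  apply/matrixP => j k; rewrite !mxE -big_split; apply: eq_bigr => i _.
  by rewrite mxE /=; ring.
have -> : cderv (X + Y) Z = cderv X Z + cderv Y Z.
  by apply/rowP => i; rewrite !mxE cderDl.
by rewrite mulmxDr addrACA.
Qed.

Lemma cnabZl a X Y : cnab (a *: X) Y = a *: cnab X Y.
Proof.
rewrite !cnabE.
have -> : conn_mx (a *: X) = a *: conn_mx X.
  apply/matrixP => j k; rewrite !mxE mulr_sumr; apply: eq_bigr => i _.
  by rewrite mxE /=; ring.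
have -> : cderv (a *: X) Y = a *: cderv X Y.
  by apply/rowP => i; rewrite !mxE cderZl.
by rewrite -scalemxAr scalerDr.
Qed.

Lemma cnabDr X Y Z : cnab X (Y + Z) = cnab X Y + cnab X Z.
Proof.
rewrite !cnabE mulmxDl.
have -> : cderv X (Y + Z) = cderv X Y + cderv X Z.
  by apply/rowP => i; rewrite !mxE cderD.
by rewrite addrACA.
Qed.

Lemma cnabZr X a Y : cnab X (a *: Y) = cder X a *: Y + a *: cnab X Y.
Proof.
rewrite !cnabE -scalemxAl.
have -> : cderv X (a *: Y) = cder X a *: Y + a *: cderv X Y.
  by apply/rowP => i; rewrite !mxE cderM.
by rewrite scalerDr addrA.
Qed.

Lemma cipDl X Y Z : cip (X + Y) Z = cip X Z + cip Y Z.
Proof. by rewrite /cip !mulmxDl mxE. Qed.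

Lemma cipZl a X Y : cip (a *: X) Y = a * cip X Y.
Proof. by rewrite /cip -!scalemxAl mxE. Qed.

Definition levi_civita : levi_civita_calculus A m := LeviCivitaCalculus
  cderD cderM cderDl cderZl cbrC cbrDr cbrZr cder_cbr cjacobi
  cnabDl cnabZl cnabDr cnabZr cipC cipDl cipZl cip_nondeg ctorsion cmetric.

End Coordinates.

(** * The ring of smooth functions on an open set *)

Record open_set (R : realType) (m : nat) := OpenSet {
  open_carrier : set 'rV[R]_m;
  open_carrier_open : open open_carrier
}.

Section SmoothRing.
Variables (R : realType) (m : nat) (D : open_set R m).
Local Notation U := (open_carrier D).

(** Elements of the ring are functions on the points of [U] only, so that equality
    on [U] is Leibniz equality; their derivatives are taken after extension by
    zero, whose germ at a point of the open set [U] is the right one. *)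
Definition point_of := {x : 'rV[R]_m | U x}.
Implicit Types (p q : point_of).

Definition extend (f : point_of -> R) : 'rV[R]_m -> R :=
  fun x => if pselect (U x) is left Ux then f (exist _ x Ux) else 0.

Lemma extendE f p : extend f (sval p) = f p.
Proof.
case: p => x Ux; rewrite /extend /=; case: pselect => // Ux'.
by rewrite (Prop_irrelevance Ux' Ux).
Qed.

Lemma smooth_extend f g : smooth_on U g -> (forall p, f p = g (sval p)) ->
  smooth_on U (extend f).
Proof.
move=> sg fg; apply: smooth_on_eq sg => [|x Ux]; first exact: open_carrier_open.
by rewrite -[x in RHS]/(sval (exist _ x Ux)) extendE fg.
Qed.

Definition smooth_fct : {pred (point_of -> R)} :=
  [pred f | `[< smooth_on U (extend f) >]].

Fact smooth_fct_subring : subring_closed smooth_fct.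
Proof.
have oU := @open_carrier_open _ _ D.
split=> [|f g /asboolP sf /asboolP sg|f g /asboolP sf /asboolP sg]; apply/asboolP.
- by apply: (@smooth_extend _ (fun=> 1)) => // k; exact: Ck_on_cst.
- apply: (@smooth_extend _ (fun x => extend f x + - extend g x)).
    by move=> k; apply: Ck_onD => //; apply: Ck_onN.
  by move=> p; rewrite !extendE.
- apply: (@smooth_extend _ (fun x => extend f x * extend g x)).
    by move=> k; apply: Ck_onM.
  by move=> p; rewrite !extendE.
Qed.

Record smooth_ring := SmoothFct {
  smooth_val :> point_of -> R;
  smooth_valP : smooth_val \in smooth_fct }.

HB.instance Definition _ := [isSub for smooth_val].
HB.instance Definition _ := [Choice of smooth_ring by <:].
HB.instance Definition _ := GRing.SubChoice_isSubComPzRing.Build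
  (point_of -> R) smooth_fct smooth_ring smooth_fct_subring.

Lemma smooth_ringP (f g : smooth_ring) : (forall p, f p = g p) -> f = g.
Proof. by move=> fg; apply/val_inj/funext. Qed.

Lemma smooth_ring_smooth (f : smooth_ring) : smooth_on U (extend f).
Proof. exact/asboolP/smooth_valP. Qed.

Definition eval_at p (f : smooth_ring) : R := f p.

Fact eval_at_zmod p : zmod_morphism (eval_at p). Proof. by []. Qed.
HB.instance Definition _ p :=
  GRing.isZmodMorphism.Build _ _ (eval_at p) (eval_at_zmod p).

Fact eval_at_monoid p : monoid_morphism (eval_at p). Proof. by []. Qed.
HB.instance Definition _ p :=
  GRing.isMonoidMorphism.Build _ _ (eval_at p) (eval_at_monoid p).

Lemma eval_atD p (f g : smooth_ring) :
  eval_at p (f + g) = eval_at p f + eval_at p g.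
Proof. exact: rmorphD. Qed.

Lemma eval_atN p (f : smooth_ring) : eval_at p (- f) = - eval_at p f.
Proof. exact: rmorphN. Qed.

Lemma eval_atM p (f g : smooth_ring) :
  eval_at p (f * g) = eval_at p f * eval_at p g.
Proof. exact: rmorphM. Qed.

Lemma eval_at_nat p n : eval_at p n%:R = n%:R.
Proof. exact: rmorph_nat. Qed.

Lemma to_smooth_proof g : smooth_on U g -> (fun p => g (sval p)) \in smooth_fct.
Proof. by move=> sg; apply/asboolP/(smooth_extend sg). Qed.

Definition to_smooth g (sg : smooth_on U g) : smooth_ring :=
  SmoothFct (to_smooth_proof sg).

Lemma eval_inj a b (F G : 'M[smooth_ring]_(a, b)) :
  (forall p, map_mx (eval_at p) F = map_mx (eval_at p) G) -> F = G.
Proof.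
move=> FG; apply/matrixP => i j; apply: smooth_ringP => p.
by have := congr1 (fun B : 'M[R]_(a, b) => B i j) (FG p); rewrite !mxE.
Qed.

Definition partial (i : 'I_m) (f : smooth_ring) : smooth_ring :=
  to_smooth (@smooth_on_partial _ _ _ _ i (smooth_ring_smooth f)).

Lemma extend_near (f : smooth_ring) g p : (forall x, U x -> g x = extend f x) ->
  \forall x \near sval p, g x = extend f x.
Proof.
move=> fg; near=> x; apply: fg; near: x.
by apply: open_nbhs_nbhs; split; [exact: open_carrier_open|exact: (svalP p)].
Unshelve. all: by end_near. Qed.

(** The bridge between functions on the whole coordinate space, in which the
    tensor calculus of a chart is written, and elements of the ring: agreement at
    the points of [U] is enough to differentiate, because [U] is open. *)
Definition represents (f : 'rV[R]_m -> R) (a : smooth_ring) :=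
  forall p, f (sval p) = eval_at p a.

Definition mx_represents k l (F : 'rV[R]_m -> 'M[R]_(k, l))
    (P : 'M[smooth_ring]_(k, l)) :=
  forall p, F (sval p) = map_mx (eval_at p) P.

Lemma represents_extend (a : smooth_ring) : represents (extend a) a.
Proof. exact: extendE. Qed.

Lemma represents_on f a : represents f a -> forall x, U x -> f x = extend a x.
Proof. by move=> fa x Ux; rewrite (fa (exist _ x Ux)) /eval_at -extendE. Qed.

Lemma represents_smooth f a : represents f a -> smooth_on U f.
Proof.
move=> fa; apply: smooth_on_eq (smooth_ring_smooth a).
  exact: open_carrier_open.
by move=> x Ux; rewrite (represents_on fa).
Qed.

Lemma mx_represents_smooth k l (F : _ -> 'M[R]_(k, l)) P :
  mx_represents F P -> smooth_mx_on U F.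
Proof.
by move=> FP i j; apply: (@represents_smooth _ (P i j)) => p; rewrite FP mxE.
Qed.

Lemma partial_represents f a i : represents f a ->
  represents (fun x => 'D_(delta_mx 0 i) f x) (partial i a).
Proof.
move=> fa p; apply: near_eq_derive.
exact: extend_near (represents_on fa).
Qed.

Lemma partialD i a b : partial i (a + b) = partial i a + partial i b.
Proof.
have E : represents (extend a + extend b) (a + b).
  by move=> p; rewrite fctE !extendE.
apply: smooth_ringP => p; rewrite -[LHS](partial_represents i E p) deriveD //.
- exact: smooth_on_derivable (smooth_ring_smooth a) (svalP p).
- exact: smooth_on_derivable (smooth_ring_smooth b) (svalP p).
Qed.

Lemma partialM i a b : partial i (a * b) = partial i a * b + a * partial i b.
Proof.
have E : represents (extend a * extend b) (a * b).
  by move=> p; rewrite fctE !extendE.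
apply: smooth_ringP => p; rewrite -[LHS](partial_represents i E p) deriveM.
- by rewrite !extendE addrC; congr (_ + _); rewrite /GRing.scale /= mulrC.
- exact: smooth_on_derivable (smooth_ring_smooth a) (svalP p).
- exact: smooth_on_derivable (smooth_ring_smooth b) (svalP p).
Qed.

Lemma partialC i j a : partial i (partial j a) = partial j (partial i a).
Proof.
apply: smooth_ringP => p.
have E k := partial_represents k (represents_extend a).
rewrite -[LHS](partial_represents i (E j) p) -[RHS](partial_represents j (E i) p).
apply: smooth_partial_comm (svalP p); first exact: open_carrier_open.
exact: smooth_ring_smooth.
Qed.

End SmoothRing.

(** * Tensor calculus in a chart, read in the ring *)

Section Transfer.
Variables (R : realType) (m : nat) (D : open_set R m).
Local Notation U := (open_carrier D).
Local Notation A := (smooth_ring D).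
Local Notation d := (@partial R m D).
Implicit Types (p : point_of D) (a b : A).

Lemma mx_entry_represents k l (F : 'rV[R]_m -> 'M[R]_(k, l)) (P : 'M[A]_(k, l)) i j :
  mx_represents F P -> represents (fun x => F x i j) (P i j).
Proof. by move=> FP p; rewrite FP mxE. Qed.

Definition mx_to_smooth k l (F : 'rV[R]_m -> 'M[R]_(k, l)) (sF : smooth_mx_on U F) :
  'M[A]_(k, l) := \matrix_(i, j) to_smooth (sF i j).

Lemma mx_to_smooth_represents k l F (sF : smooth_mx_on U F) :
  mx_represents F (@mx_to_smooth k l F sF).
Proof. by move=> p; apply/matrixP => i j; rewrite !mxE. Qed.

Definition mx_extend k l (P : 'M[A]_(k, l)) : 'rV[R]_m -> 'M[R]_(k, l) :=
  fun x => \matrix_(i, j) extend (P i j) x.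

Lemma mx_extend_represents k l (P : 'M[A]_(k, l)) : mx_represents (mx_extend P) P.
Proof. by move=> p; apply/matrixP => i j; rewrite !mxE extendE. Qed.

Lemma derive_represents V X f a : @mx_represents R m D 1 m V X ->
  represents f a -> represents (fun x => 'D_(V x) f x) (cder d X a).
Proof.
move=> VX fa p.
have [_ ->] := smooth_is_derive (V (sval p)) (@open_carrier_open _ _ D)
  (represents_smooth fa) (svalP p).
rewrite VX rmorph_sum; apply: eq_bigr => i _.
by rewrite (partial_represents i fa) rmorphM mxE.
Qed.

Lemma derive_mx_represents k l V X F (P : 'M[A]_(k, l)) :
  @mx_represents R m D 1 m V X -> mx_represents F P ->
  mx_represents (fun x => 'D_(V x) F x) (cderv d X P).
Proof.
move=> VX FP p.
rewrite (smooth_mx_derive _ (@open_carrier_open _ _ D) (mx_represents_smooth FP)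
  (svalP p)).
apply/matrixP => i j; rewrite !mxE rmorph_sum; apply: eq_bigr => h _.
by rewrite VX rmorphM mxE (partial_represents h (mx_entry_represents i j FP)).
Qed.

Lemma br_represents V X W Y : @mx_represents R m D 1 m V X ->
  @mx_represents R m D 1 m W Y -> mx_represents (lie_bracket V W) (cbr d X Y).
Proof.
move=> VX WY p; rewrite /lie_bracket map_mxB.
by rewrite (derive_mx_represents VX WY) (derive_mx_represents WY VX).
Qed.

Lemma bilin_represents B P V X W Y : @mx_represents R m D m m B P ->
  @mx_represents R m D 1 m V X -> @mx_represents R m D 1 m W Y ->
  represents (fun x => bilin (B x) (V x) (W x)) ((X *m P *m Y^T) 0 0).
Proof.
move=> BP VX WY p.
rewrite /bilin BP VX WY (_ : (map_mx (eval_at p) Y)^T = map_mx (eval_at p) Y^T).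
  by rewrite -!map_mxM mxE.
by apply/matrixP => i j; rewrite !mxE.
Qed.

Variables (g : 'rV[R]_m -> 'M[R]_m) (G H : 'M[A]_m).
Hypotheses (gG : mx_represents g G) (GH : G *m H = 1%:M).
Variable half : A.
Hypothesis halfE : represents (fun=> 2^-1) half.

Lemma inv_represents : mx_represents (fun x => invmx (g x)) H.
Proof.
move=> p; have := congr1 (map_mx (eval_at p)) GH.
rewrite map_mxM map_scalar_mx rmorph1 -gG => E.
have [gu _] := mulmx1_unit E.
by rewrite -[RHS](mulKmx gu) E mulmx1.
Qed.

Lemma christoffel_represents i j k :
  represents (fun x => christoffel g x i j k) (cchristoffel d half G H i j k).
Proof.
move=> p; rewrite /christoffel /cchristoffel rmorphM rmorph_sum.
congr (_ * _); first exact: (halfE p).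
apply: eq_bigr => l _; rewrite rmorphM rmorphB rmorphD.
rewrite (partial_represents i (mx_entry_represents j l gG)).
rewrite (partial_represents j (mx_entry_represents i l gG)).
rewrite (partial_represents l (mx_entry_represents i j gG)).
by rewrite (mx_entry_represents k l inv_represents).
Qed.

Lemma nabla_represents V X W Y : @mx_represents R m D 1 m V X ->
  @mx_represents R m D 1 m W Y ->
  mx_represents (nabla g V W) (cnab d half G H X Y).
Proof.
move=> VX WY p; rewrite /nabla map_mxD (derive_mx_represents VX WY); congr (_ + _).
apply/rowP => k; rewrite !mxE raddf_sum; apply: eq_bigr => i _.
rewrite raddf_sum; apply: eq_bigr => j _.
rewrite -[RHS]/(eval_at p _) rmorphM [X in _ = X * _]rmorphM VX WY !mxE.
by congr (_ * _); exact: (christoffel_represents i j k p).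
Qed.

Hypotheses (half2 : half * 2%:R = 1) (symG : G^T = G).

Definition chart_calculus : levi_civita_calculus A m :=
  levi_civita (@partialD _ _ D) (@partialM _ _ D) (@partialC _ _ D) half2 symG GH.
Local Notation K := chart_calculus.

Lemma curvature_represents V X W Y S Z : @mx_represents R m D 1 m V X ->
  @mx_represents R m D 1 m W Y -> @mx_represents R m D 1 m S Z ->
  mx_represents (curvature g V W S) (curv K X Y Z).
Proof.
move=> VX WY SZ p; rewrite /curvature !map_mxB.
rewrite (nabla_represents VX (nabla_represents WY SZ)).
rewrite (nabla_represents WY (nabla_represents VX SZ)).
by rewrite (nabla_represents (br_represents VX WY) SZ).
Qed.

Lemma coord_field_represents i :
  mx_represents (@coord_field R m i) (delta_mx 0 i : 'rV[A]_m).
Proof. by move=> p; rewrite map_delta_mx. Qed.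

Lemma ricci_represents : mx_represents (ricci g) (ric_mx K).
Proof.
move=> p; apply/matrixP => j k; rewrite !mxE rmorph_sum; apply: eq_bigr => i _.
by rewrite (curvature_represents (@coord_field_represents i)
  (@coord_field_represents j) (@coord_field_represents k)) mxE.
Qed.

Lemma lie_metric_represents V X W Y S Z : @mx_represents R m D 1 m V X ->
  @mx_represents R m D 1 m W Y -> @mx_represents R m D 1 m S Z ->
  represents (lie_metric V g W S) (lie K X (ip K) Y Z).
Proof.
move=> VX WY SZ p; rewrite /lie_metric !rmorphB.
rewrite (derive_represents VX (bilin_represents gG WY SZ)).
rewrite (bilin_represents gG (br_represents VX WY) SZ).
by rewrite (bilin_represents gG WY (br_represents VX SZ)).
Qed.

End Transfer.

(** * Rigidity in one chart *)

Section Pointwise.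
Variables (R : realType) (m : nat).
Implicit Types (u v : 'rV[R]_m) (a : 'cV[R]_m) (B : 'M[R]_m).

Lemma pairingD a u v : pairing a (u + v) = pairing a u + pairing a v.
Proof. by rewrite /pairing mulmxDl mxE. Qed.

Lemma pairingZ a (k : R) u : pairing a (k *: u) = k * pairing a u.
Proof. by rewrite /pairing -scalemxAl mxE. Qed.

Lemma bilin_delta B i j : bilin B (delta_mx 0 i) (delta_mx 0 j) = B i j.
Proof. by rewrite /bilin -rowE trmx_delta -colE !mxE. Qed.

Lemma sym_mx_of_bilin B : (forall u v, bilin B u v = bilin B v u) -> B^T = B.
Proof. by move=> H; apply/matrixP => i j; rewrite mxE -!bilin_delta. Qed.

Lemma definite_det_neq0 B : (forall u, u != 0 -> 0 < bilin B u u) -> \det B != 0.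
Proof.
move=> H; apply/negP => /det0P [v v0 vB].
by have := H v v0; rewrite /bilin vB mul0mx mxE ltxx.
Qed.

Section AlmostContact.
Variables (P B : 'M[R]_m) (xi : 'rV[R]_m) (eta : 'cV[R]_m).
Hypothesis PP : forall u, (u *m P) *m P = - u + pairing eta u *: xi.
Hypothesis eta_xi : pairing eta xi = 1.
Hypothesis comp : forall u v, bilin B (u *m P) (v *m P) =
    bilin B u v - pairing eta u * pairing eta v.

(** From phi^2 xi = 0 and the structure equation at phi xi, the vector phi xi is a
    multiple a xi of xi, and then phi^2 xi = a^2 xi forces a = 0. *)
Lemma phi_xi : xi *m P = 0.
Proof.
have h1 : xi *m P *m P = 0 by rewrite PP eta_xi scale1r addNr.
have h2 : xi *m P = pairing eta (xi *m P) *: xi.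
  have := PP (xi *m P); rewrite h1 mul0mx => /eqP.
  by rewrite eq_sym addrC subr_eq0 => /eqP/esym.
have : pairing eta (xi *m P *m P) = 0 by rewrite h1 /pairing mul0mx mxE.
move: h2; set a := pairing eta (xi *m P) => h2.
rewrite h2 -scalemxAl h2 scalerA pairingZ eta_xi mulr1 => /eqP.
by rewrite mulf_eq0 orbb => /eqP ->; rewrite scale0r.
Qed.

(** Compare phi^3 u computed in the two possible orders. *)
Lemma eta_phi u : pairing eta (u *m P) = 0.
Proof.
have := PP (u *m P).
rewrite [in LHS](PP u) mulmxDl -scalemxAl phi_xi scaler0 addr0 mulNmx.
move=> /eqP; rewrite -subr_eq0 opprD addrA subrr sub0r oppr_eq0 => /eqP.
by move=> /(congr1 (pairing eta)); rewrite pairingZ eta_xi mulr1 => ->;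
  rewrite /pairing mul0mx mxE.
Qed.

Lemma eta_metric u : pairing eta u = bilin B u xi.
Proof.
have := comp u xi; rewrite phi_xi eta_xi mulr1 /bilin trmx0 mulmx0 mxE.
by move=> /esym/eqP; rewrite subr_eq0 => /eqP <-.
Qed.

End AlmostContact.
End Pointwise.

Section Local.
Variables (R : realType) (m : nat) (D : open_set R m).
Local Notation U := (open_carrier D).
Local Notation A := (smooth_ring D).

Definition const_smooth (r : R) : A :=
  @to_smooth _ _ D (fun=> r) (fun k => Ck_on_cst k r (@open_carrier_open _ _ D)).

Lemma const_smooth_represents r : represents (fun=> r) (const_smooth r).
Proof. by []. Qed.

Lemma partial_const r i : partial i (const_smooth r) = 0.
Proof.
apply: smooth_ringP => p.
rewrite -[LHS](partial_represents i (const_smooth_represents r) p).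
exact: derive_cst.
Qed.

(** Cramer's rule over the ring of smooth functions: only the determinant has to
    be inverted. *)
Lemma metric_inverse (g : 'rV[R]_m -> 'M[R]_m) (G : 'M[A]_m) :
  mx_represents g G -> (forall x, U x -> \det (g x) != 0) ->
  exists H : 'M[A]_m, G *m H = 1%:M.
Proof.
move=> gG g0.
have det0 x : U x -> extend (\det G) x != 0.
  move=> Ux; rewrite -[x]/(sval (exist _ x Ux)) extendE.
  rewrite -[smooth_val _ _]/(eval_at _ _) -det_map_mx -gG; exact: g0.
have sdet : smooth_on U (fun x => (extend (\det G) x)^-1).
  move=> k; apply: Ck_onV => //; first exact: open_carrier_open.
  exact: smooth_ring_smooth.
exists (to_smooth sdet *: \adj G).
rewrite -scalemxAr mul_mx_adj scale_scalar_mx; congr (_%:M).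
apply: smooth_ringP => p; rewrite -[LHS]/(eval_at p (_ * _)) rmorphM.
rewrite /eval_at /= extendE mulVf//.
by have := det0 _ (svalP p); rewrite extendE.
Qed.

Variables (phi g : 'rV[R]_m -> 'M[R]_m) (xi V : 'rV[R]_m -> 'rV[R]_m).
Variables (eta : 'rV[R]_m -> 'cV[R]_m) (rho : 'rV[R]_m -> R) (lambda mu : R).
Hypotheses (sg : smooth_mx_on U g)
  (sxi : smooth_mx_on U xi) (sV : smooth_mx_on U V) (srho : smooth_on U rho).
Hypothesis g_sym : forall x, U x -> forall u v, bilin (g x) u v = bilin (g x) v u.
Hypothesis g_pos : forall x, U x -> forall u, u != 0 -> 0 < bilin (g x) u u.
Hypothesis contact : forall x, U x ->
  (forall u : 'rV[R]_m, (u *m phi x) *m phi x = - u + pairing (eta x) u *: xi x) /\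
  pairing (eta x) (xi x) = 1.
Hypothesis compatible : forall x, U x -> forall u v : 'rV[R]_m,
  bilin (g x) (u *m phi x) (v *m phi x) =
  bilin (g x) u v - pairing (eta x) u * pairing (eta x) v.
Hypothesis kenmotsu_eq : forall X Y : 'rV[R]_m -> 'rV[R]_m,
  smooth_mx_on U X -> smooth_mx_on U Y -> forall x, U x ->
  nabla_tensor11 g phi X Y x = bilin (g x) (X x *m phi x) (Y x) *: xi x
      - pairing (eta x) (Y x) *: (X x *m phi x).
Hypothesis soliton_eq : forall X Y : 'rV[R]_m -> 'rV[R]_m,
  smooth_mx_on U X -> smooth_mx_on U Y -> forall x, U x ->
  2^-1 * lie_metric V g X Y x + bilin (ricci g x) (X x) (Y x)
  + lambda * bilin (g x) (X x) (Y x)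
  + mu * (pairing (eta x) (X x) * pairing (eta x) (Y x)) = 0.
Hypothesis contact_eq : forall X : 'rV[R]_m -> 'rV[R]_m,
  smooth_mx_on U X -> forall x, U x ->
  lie_one_form V eta X x = rho x * pairing (eta x) (X x).

(** All data are transported to the ring of smooth functions, where [rho_kap] and
    [ric_einstein] apply; evaluation at [x] brings their conclusions back. *)
Lemma local_rigidity : (1 < m)%N -> forall x, U x ->
  rho x = 0 /\ ricci g x = - (m%:R - 1) *: g x.
Proof.
move=> m1.
pose G := mx_to_smooth sg; pose Xi := mx_to_smooth sxi; pose W := mx_to_smooth sV.
have gG : mx_represents g G := mx_to_smooth_represents sg.
have xiX : mx_represents xi Xi := mx_to_smooth_represents sxi.
have VW : mx_represents V W := mx_to_smooth_represents sV.
have phi_xi0 x (Ux : U x) := phi_xi (contact Ux).1 (contact Ux).2.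
have eta_phi0 x (Ux : U x) := eta_phi (contact Ux).1 (contact Ux).2.
have eta_g x (Ux : U x) :=
  eta_metric (contact Ux).1 (contact Ux).2 (compatible Ux).
have [H GH] : exists H, G *m H = 1%:M.
  by apply: (metric_inverse gG) => x Ux; exact: definite_det_neq0 (g_pos Ux).
pose half := const_smooth 2^-1.
have halfE : represents (fun=> 2^-1) half by [].
have half2 : half * 2%:R = 1.
  apply: smooth_ringP => p; rewrite -[LHS]/(2^-1 * eval_at p 2%:R) rmorph_nat.
  by rewrite mulVf ?pnatr_eq0.
have symG : G^T = G.
  apply: eval_inj => p.
  have := sym_mx_of_bilin (g_sym (svalP p)); rewrite gG => E.
  by rewrite -[RHS]E; apply/matrixP => i j; rewrite !mxE.
pose K := chart_calculus GH half2 symG.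
have ipE X Y x y : mx_represents x X -> mx_represents y Y ->
    represents (fun z => bilin (g z) (x z) (y z)) (ip K X Y).
  exact: bilin_represents.
have etaE X x : mx_represents x X ->
    represents (fun z => pairing (eta z) (x z)) (reeb_form K Xi X).
  by move=> xX p; rewrite (eta_g _ (svalP p)) (ipE X Xi).
have xi_unit : ip K Xi Xi = 1.
  by apply: smooth_ringP => p; rewrite -[LHS](etaE _ _ xiX p) (contact (svalP p)).2.
have nab_xi X : nab K X Xi = X - ip K X Xi *: Xi.
  apply: eval_inj => p; have Up := svalP p.
  have rX := mx_extend_represents X.
  have sX := mx_represents_smooth rX.
  have rN := nabla_represents gG GH halfE rX xiX.
  have := kenmotsu_eq sX sxi Up; rewrite /nabla_tensor11.
  have r0 : mx_represents (fun y => xi y *m phi y) (0 : 'rV[A]_m).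
    by move=> q; rewrite (phi_xi0 _ (svalP q)) raddf0.
  rewrite (nabla_represents gG GH halfE rX r0).
  have -> : cnab (@partial _ _ D) half G H X 0 = 0.
    by have := nabZr K X 0 0; rewrite !scale0r scaler0 addr0.
  rewrite raddf0 sub0r (contact Up).2 scale1r -(eta_g _ Up) eta_phi0// scale0r sub0r.
  move=> /oppr_inj E.
  set N := nabla g _ _ _ in E; set v := mx_extend X (sval p) in E.
  (* phi kills nabla_X xi - X, which is therefore a multiple of xi; its
     coefficient follows from nabla_X xi being orthogonal to the unit field xi. *)
  have E1 : (N - v) *m phi (sval p) *m phi (sval p) = 0.
    by rewrite mulmxBl E subrr mul0mx.
  have E2 : N - v = pairing (eta (sval p)) (N - v) *: xi (sval p).
    move: E1; rewrite (contact Up).1 => /eqP.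
    by rewrite addrC subr_eq0 => /eqP/esym.
  have E3 : pairing (eta (sval p)) N = 0.
    have nx : ip K (nab K X Xi) Xi = 0.
      apply: (two_inj half2); rewrite mulr0.
      have := metric_compat K X Xi Xi; rewrite xi_unit der1 (ipC K Xi) => ->.
      by ring.
    rewrite (eta_g _ Up); have := ipE (nab K X Xi) Xi _ _ rN xiX p.
    by rewrite nx => ->.
  rewrite -rN -/N -[N](subrK v) E2 pairingD E3.
  rewrite add0r -scaleN1r pairingZ mulN1r scaleNr addrC map_mxB map_mxZ -rX -xiX.
  by congr (_ - _ *: _); exact: (etaE _ _ rX p).
pose Rho := to_smooth srho.
have solitonE X Y : lie K W (ip K) X Y =
   - (2%:R * (ric K X Y + const_smooth lambda * ip K X Y
       + const_smooth mu * (reeb_form K Xi X * reeb_form K Xi Y))).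
  apply: smooth_ringP => p; have Up := svalP p.
  have rX := mx_extend_represents X; have rY := mx_extend_represents Y.
  have := soliton_eq (mx_represents_smooth rX) (mx_represents_smooth rY) Up.
  rewrite (etaE _ _ rX p) (etaE _ _ rY p) (ipE _ _ _ _ rX rY p).
  rewrite (lie_metric_represents gG GH half2 symG VW rX rY p).
  rewrite (bilin_represents (ricci_represents gG GH halfE half2 symG) rX rY p).
  rewrite ric_mxE => E.
  have F : eval_at p (lie K W (ip K) X Y) = - (2 * (eval_at p (ric K X Y) +
      lambda * eval_at p (ip K X Y) +
      mu * (eval_at p (reeb_form K Xi X) * eval_at p (reeb_form K Xi Y)))).
    move: E; move: (eval_at p _) (eval_at p _) (eval_at p _) => l r i.
    by move: (_ * eval_at p _) => e E; lra.
  rewrite [LHS]F -[RHS]/(eval_at p (- _)) eval_atN eval_atM eval_at_nat !eval_atD.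
  by rewrite !(eval_atM p (const_smooth _)) eval_atM.
have contactE X : der K W (reeb_form K Xi X) - reeb_form K Xi (br K W X) =
    Rho * reeb_form K Xi X.
  apply: smooth_ringP => p; have Up := svalP p.
  have rX := mx_extend_represents X.
  have := contact_eq (mx_represents_smooth rX) Up; rewrite /lie_one_form.
  rewrite (derive_represents VW (etaE _ _ rX)).
  by rewrite (etaE _ _ (br_represents VW rX)) (etaE _ _ rX p).
have constE r X : der K X (const_smooth r) = 0.
  by apply: big1 => i _; rewrite partial_const mulr0.
have k0 := rho_kap half2 xi_unit nab_xi (constE lambda) (constE mu)
  solitonE contactE.
have ricE := ric_einstein half2 xi_unit nab_xi (constE lambda) (constE mu)
  solitonE contactE.
move=> x Ux; pose p : point_of D := exist _ x Ux.
have ip_delta i j : eval_at p (ip K (delta_mx 0 i) (delta_mx 0 j)) = g x i j.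
  rewrite -[g x]/(g (sval p)) -bilin_delta.
  exact/esym/(ipE _ _ _ _ (@coord_field_represents _ _ D i)
    (@coord_field_represents _ _ D j) p).
split; last first.
  rewrite -[x]/(sval p) (ricci_represents gG GH halfE half2 symG p).
  apply/matrixP => i j; rewrite !mxE -/(ric K _ _) ricE.
  by rewrite -[LHS]/(eval_at p (_ * _)) eval_atM ip_delta eval_atN eval_atD
    eval_atN !eval_at_nat.
apply/eqP/negPn/negP => rho0.
(* If rho did not vanish at x, the metric would equal eta (x) eta there, which
   has trace 1 and not m. *)
have gk : g x = (g x *m (xi x)^T) *m (g x *m (xi x)^T)^T.
  have eta_delta i :
      eval_at p (reeb_form K Xi (delta_mx 0 i)) = (g x *m (xi x)^T) i 0.
    rewrite -(etaE _ _ (@coord_field_represents _ _ D i) p) (eta_g _ Ux).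
    by rewrite /bilin -mulmxA -rowE mxE.
  apply/matrixP => i j; rewrite mxE big_ord1 [X in _ * X]mxE.
  have := congr1 (eval_at p) (k0 (delta_mx 0 i) (delta_mx 0 j)).
  rewrite eval_atM /kap eval_atD eval_atN eval_atM ip_delta !eta_delta.
  move/eqP; rewrite [_ == _]mulf_eq0 => /orP[/eqP r0|].
    by move: rho0; rewrite -[rho x]/(eval_at p Rho) r0 eqxx.
  by rewrite subr_eq0 => /eqP.
have gu : g x \in unitmx.
  by rewrite unitmxE unitfE; exact: definite_det_neq0 (g_pos Ux).
have trm : (m%:R : R) = 1.
  rewrite -(mxtrace1 R m) -(mulVmx gu) {2}gk.
  rewrite mulmxA (mulmxA (invmx _)) mulVmx// mul1mx.
  rewrite trmx_mul trmxK mxtrace_mulC -mulmxA.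
  have -> : (g x)^T = g x by apply: sym_mx_of_bilin; exact: g_sym.
  rewrite /mxtrace big_ord1 mulmxA -/(bilin (g x) (xi x) (xi x)).
  by rewrite -(eta_g _ Ux) (contact Ux).2.
by move: m1; rewrite -(ltr_nat R) trm ltxx.
Qed.

End Local.

(** * Rigidity of the manifold *)

Theorem theorem3p2 (R : realType) (n : nat) (hn : (1 < n)%N)
  (M : smooth_manifold R (2 * n + 1)) (phi : tensor11 M) (xi : vector_field M)
  (eta : one_form M) (g : riemannian_metric M)
  (hK : kenmotsu phi xi eta g)
  (V : vector_field M) (lambda mu : R)
  (hsol : eta_ricci_soliton eta g V lambda mu)
  (rho : M -> R) (hrho : smooth_function rho)
  (hV : infinitesimal_contact eta V rho) :
  (forall p : M, rho p = 0) /\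
  einstein g /\
  has_constant_scalar_curvature g (- (2 * n * (2 * n + 1))%:R).
Proof.
have hm : (1 < 2 * n + 1)%N by rewrite addn1 ltnS muln_gt0 (ltnW hn).
have [[hcontact hcomp] hken] := hK.
have local c x : img c x -> rho (chart_inv (atlas c) x) = 0 /\
    ricci (g c) x = - ((2 * n + 1)%:R - 1) *: g c x.
  move=> cx; pose D := @OpenSet R _ (img c) (@chart_img_open _ _ _ (atlas c)).
  exact: (@local_rigidity R _ D (phi c) (g c) (xi c) (V c) (eta c)
    (fun y => rho (chart_inv (atlas c) y)) lambda mu
    (@rm_smooth _ _ _ g c) (@vf_smooth _ _ _ xi c) (@vf_smooth _ _ _ V c) (hrho c)
    (@rm_sym _ _ _ g c) (@rm_pos _ _ _ g c) (@hcontact c) (@hcomp c)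
    (@hken c) (@hsol c) (@hV c) hm x cx).
split; [move=> p|split].
- have [c cp] := atlas_cover p.
  have [] := @local c (chart_map (atlas c) p); first by exists p.
  by rewrite chart_mapK.
- by exists (- ((2 * n + 1)%:R - 1)) => c x cx; have [] := local c x cx.
- move=> c x cx; have [_ ricE] := local c x cx.
  have gu : g c x \in unitmx.
    by rewrite unitmxE unitfE; exact: definite_det_neq0 (@rm_pos _ _ _ g c x cx).
  rewrite /scalar_curvature ricE -scalemxAr mulVmx// mxtraceZ mxtrace1.
  by rewrite natrM natrD; ring.
Qed.
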